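(* Let $X^{f}$ be a $\ast\ast$-closed superreflexive class of finite equivalence, and let $E_X\in X^{f}$ be a separable space of almost universal disposition with respect to $\mathfrak{M}(X^{f})$. Then the conjugate $(E_X)^{\ast}$ is couniversal for all separable Banach spaces that are finitely representable in $\ast(X^{f})$; that is, for every separable Banach space $F$ finitely representable in $\ast(X^{f})$ there is a continuous linear surjection $(E_X)^{\ast}\to F$.
   Context: Finite representability: for Banach spaces $X,Y$, $X<_f Y$ means that for every $\varepsilon>0$ and every finite dimensional subspace $A$ of $X$ there are a subspace $B$ of $Y$ and an isomorphism $u:A\to B$ with $\|u\|\,\|u^{-1}\|\le 1+\varepsilon$. $X\sim_f Y$ means $X<_fY$ and $Y<_fX$; the class of finite equivalence of $X$ is $X^{f}=\{Y: X\sim_f Y\}$. A space is finitely representable in a class $X^f$ if it is finitely representable in some (equivalently, every) member of it. Minkowski's base: $\mathfrak{M}$ is the set of all finite dimensional Banach spaces (isometric spaces identified), the disjoint union over $n$ of the sets $\mathfrak{M}_n$ of $n$-dimensional spaces, each with the metric $\log d$, $d$ the Banach–Mazur distance. $H(X)\subseteq\mathfrak{M}$ is the set of finite dimensional subspaces of $X$, and $\mathfrak{M}(X^{f})$ is the closure of $H(X)$ in $\mathfrak{M}$. It depends only on $X^{f}$ and determines $X^{f}$. Operations: for $K\subseteq\mathfrak{M}$, $H(K)$ is the set of all subspaces of members of $K$, $Q(K)$ is the set of all quotients of members of $K$, and $HQ(K)=H(Q(K))$. Let $l_2(X)$ be the $l_2$-sum of countably many copies of $X$ and $\mathsf{D}_2(X^{f})=(l_2(X))^{f}$.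 The class $\ast\ast(X^{f})$ is the class $W^{f}$ with $\mathfrak{M}(W^{f})=HQ\,\mathfrak{M}(\mathsf{D}_2(X^{f}))$. A class $X^{f}$ is $\ast\ast$-closed if $X^{f}=\ast\ast(W^{f})$ for some Banach space $W$. The procedure $\ast$ (also written $\star$): choose a countable dense subset $(Y_n)_{n<\infty}$ of $\mathfrak{M}(\mathsf{D}_2(X^{f}))$, put $Z=(\sum_{n}\oplus Y_n)_2$ ($l_2$-sum), and set $\ast(X^{f})=(Z^{\ast})^{f}$. A class $X^{f}$ is superreflexive if every space in $X^{f}$ is reflexive (equivalently, every $Y<_fX$ is reflexive). Almost universal disposition: a Banach space $E$ is of almost universal disposition with respect to a class $\mathcal{K}$ of Banach spaces if for all $A,B\in\mathcal{K}$ with $A$ a subspace of $B$, every $\varepsilon>0$ and every isomorphic embedding $i:A\to E$ there is an isomorphic embedding $\hat\imath:B\to E$ with $\hat\imath|_A=i$ and $\|\hat\imath\|\,\|\hat\imath^{-1}\|\le(1+\varepsilon)\|i\|\,\|i^{-1}\|$ (inverses taken on the images). *)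

(* Defs.v *)
From HB Require Import structures.
From mathcomp Require Import all_boot all_order all_algebra.
From mathcomp Require Import all_classical all_reals all_analysis.
From mathcomp Require Import ring.

Set Implicit Arguments.
Unset Strict Implicit.
Unset Printing Implicit Defensive.

Import Order.TTheory GRing.Theory Num.Theory.
Import numFieldNormedType.Exports.

Local Open Scope classical_set_scope.
Local Open Scope ring_scope.

Section operator_norms.
Variables (R : realType) (V W : normedModType R).
Implicit Type u : {linear V -> W}.

(* sup is 0 on unbounded sets: opnorm and opnorm_inv are meaningful only for
   continuous maps, respectively for maps that are bounded below. *)
Definition opnorm (f : V -> W) : R := sup [set `|f x| | x in [set x | `|x| <= 1]].

Definition iso_embedding u : Prop :=
  continuous u /\ exists2 c, 0 < c & forall x, c * `|x| <= `|u x|.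

Definition isomorphism u : Prop := iso_embedding u /\ forall y, exists x, u x = y.

(* Norm of the inverse of u, defined on the range of u. *)
Definition opnorm_inv u : R := sup [set `|x| | x in [set x | `|u x| <= 1]].

(* The product is at least 1 unless V is the zero space, where it is 0; the
   maximum gives the only embedding of the zero space distortion 1, so that
   the Banach-Mazur distance from the zero space to itself is 1. *)
Definition distortion u : R := Num.max 1 (opnorm u * opnorm_inv u).

Definition isometric u : Prop := forall x, `|u x| = `|x|.

End operator_norms.

Section filters.
Variables (R : realType) (V W : normedModType R).

Lemma cvg_dist_le (T : Type) (F : set_system T) (h : T -> W) (y l : W) (c : R) :
  ProperFilter F -> h @ F --> l -> (\forall t \near F, `|y - h t| <= c) ->
  `|y - l| <= c.
Proof.
move=> FF hl hc; apply: (cvgr_to_le (f := fun t => `|y - h t|)) hc.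
by apply: cvg_norm; apply: cvgB => //; exact: cvg_cst.
Qed.

Lemma cauchy_near (F : set_system V) (e : R) : ProperFilter F -> cauchy F ->
  0 < e -> exists g, \forall f \near F, `|g - f| < e.
Proof. by move=> FF /cauchyP + e0 => /(_ _ e0)[g]; rewrite -ball_normE; exists g. Qed.

Lemma cauchy_near_near (F : set_system V) (e : R) : ProperFilter F -> cauchy F ->
  0 < e -> \forall f \near F, \forall h \near F, `|f - h| < e.
Proof.
move=> FF Fc e0; have [|g gF] := @cauchy_near F (e / 2) _ Fc; first by rewrite divr_gt0.
near=> f; near=> h.
have fg : `|g - f| < e / 2 by near: f.
have hg : `|g - h| < e / 2 by near: h.
by rewrite (splitr e) (le_lt_trans (ler_distD g _ _))// distrC ltrD.
Unshelve. all: by end_near. Qed.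

End filters.

Lemma cauchy_lipschitz_cvg (R : realType) (V : normedModType R)
    (W : completeNormedModType R) (F : set_system V) (p : V -> W) (C : R) :
  ProperFilter F -> cauchy F -> (forall x y, `|p x - p y| <= C * `|x - y|) ->
  cvg (p @ F).
Proof.
move=> FF Fc pC; apply: cauchy_cvg; apply: cauchy_exP => e e0.
have C0 : 0 < `|C| + 1 by rewrite ltr_wpDl.
have [|g gF] := @cauchy_near _ _ F (e / (`|C| + 1)) _ Fc; first by rewrite divr_gt0.
exists (p g); apply: filterS gF => f; rewrite ltr_pdivlMr// mulrC => fg.
rewrite -ball_normE/=; apply: le_lt_trans (pC _ _) (le_lt_trans _ fg).
by rewrite ler_wpM2r// (le_trans (ler_norm _))// lerDl.
Qed.

Section dual_space.
Variables (R : realType) (V : normedModType R).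

Definition dual_pred : {pred V -> R^o} :=
  fun f => `[< linear f /\ continuous f >].

Record dual := Dual { dual_val :> V -> R^o ; dualP : dual_pred dual_val }.

HB.instance Definition _ := [isSub for dual_val].
HB.instance Definition _ := gen_eqMixin dual.
HB.instance Definition _ := gen_choiceMixin dual.

Lemma dual_submod : submod_closed dual_pred.
Proof.
split.
  apply/asboolP; split; first by move=> a x y; rewrite scaler0 addr0.
  exact: cst_continuous.
move=> a f g /asboolP[lf cf] /asboolP[lg cg]; apply/asboolP; split.
  move=> b x y; rewrite !fctE lf lg.
  by rewrite !scalerDr !scalerA [a * b]mulrC addrACA.
move=> x; apply: cvgD; last exact: cg.
by apply: cvgZl_tmp; exact: cf.
Qed.

HB.instance Definition _ := GRing.isSubmodClosed.Build R (V -> R^o) dual_pred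
  dual_submod.
HB.instance Definition _ := [SubChoice_isSubLmodule of dual by <:].


Lemma dual_linear (f : dual) : linear (f : V -> R^o).
Proof. by case: f => f /= /asboolP[]. Qed.

HB.instance Definition _ (f : dual) :=
  GRing.isLinear.Build R V R^o _ (dual_val f) (dual_linear f).

Lemma dual_continuous (f : dual) : continuous (f : V -> R^o).
Proof. by case: f => f /= /asboolP[]. Qed.

Let dual_bounded (f : dual) : exists2 M, 0 < M & forall x, `|f x| <= M * `|x|.
Proof.
have /linear_bounded_continuous/linear_boundedP := @dual_continuous f.
by move=> /pinfty_ex_gt0[M M0 h]; exists M.
Qed.

Let dual_has_sup (f : dual) : has_sup [set `|f x| | x in [set x | `|x| <= 1]].
Proof.
have [M M0 fM] := dual_bounded f; split.
  by exists `|f 0|, 0 => //=; rewrite normr0 ler01.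
exists M => _ [x /= x1 <-]; apply: le_trans (fM x) _.
by rewrite ler_piMr// ltW.
Qed.

Lemma dual_opnorm_ge0 (f : dual) : 0 <= opnorm f.
Proof.
have /ubP ub := sup_upper_bound (dual_has_sup f).
apply: ub; exists 0 => /=; first by rewrite normr0 ler01.
by rewrite linear0 normr0.
Qed.

Lemma dual_opnormP (f : dual) x : `|f x| <= opnorm f * `|x|.
Proof.
have [->|x0] := eqVneq x 0; first by rewrite linear0 !normr0 mulr0.
rewrite -ler_pdivrMr ?normr_gt0//.
have /ubP ub := sup_upper_bound (dual_has_sup f).
apply: ub; exists (`|x|^-1 *: x) => /=.
  by rewrite normrZ normfV normr_id mulVf// normr_eq0.
by rewrite linearZ normrZ normfV normr_id mulrC.
Qed.

Lemma dual_opnorm_le (f : dual) M : 0 <= M ->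
  (forall x, `|f x| <= M * `|x|) -> opnorm f <= M.
Proof.
move=> M0 fM; apply: ge_sup; first by case: (dual_has_sup f).
by move=> _ [x /= x1 <-]; apply: le_trans (fM x) _; rewrite ler_piMr.
Qed.

Let dual_normD (f g : dual) : opnorm (f + g)%R <= opnorm f + opnorm g.
Proof.
apply: dual_opnorm_le => [|x]; first by rewrite addr_ge0 ?dual_opnorm_ge0.
rewrite (_ : (f + g)%R x = f x + g x)//.
by rewrite mulrDl (le_trans (ler_normD _ _))// lerD// dual_opnormP.
Qed.

Let dual_normZ (a : R) (f : dual) : opnorm (a *: f) = `|a| * opnorm f.
Proof.
have H (b : R) (g : dual) : opnorm (b *: g) <= `|b| * opnorm g.
  apply: dual_opnorm_le => [|x]; first by rewrite mulr_ge0 ?dual_opnorm_ge0.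
  rewrite (_ : (b *: g) x = b *: g x)// normrZ -mulrA.
  by rewrite ler_wpM2l// dual_opnormP.
apply/eqP; rewrite eq_le H andTb.
have [->|a0] := eqVneq a 0; first by rewrite normr0 mul0r; exact: dual_opnorm_ge0.
rewrite -ler_pdivlMl ?normr_gt0//.
by have := H a^-1 (a *: f); rewrite scalerA mulVf// scale1r normfV.
Qed.

Let dual_norm_eq0 (f : dual) : opnorm f = 0 -> f = 0.
Proof.
move=> f0; apply: val_inj; apply/funext => x; apply/eqP.
by rewrite -normr_le0; have := dual_opnormP f x; rewrite f0 mul0r.
Qed.

HB.instance Definition _ := Lmodule_isNormed.Build R dual
  dual_normD dual_normZ dual_norm_eq0.

Lemma dual_cauchy_cvg (F : set_system dual) :
  ProperFilter F -> cauchy F -> cvg F.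
Proof.
move=> FF Fc.
have lE x : cvg ((fun f : dual => f x) @ F).
  apply: (@cauchy_lipschitz_cvg _ _ _ _ _ `|x|) => // f g.
  by rewrite mulrC; exact: (dual_opnormP (f - g)%R x).
pose l x : R^o := lim ((fun f : dual => f x) @ F).
have ll : linear l.
  move=> a x y; apply/cvg_lim => //=.
  rewrite (_ : (fun f : dual => f (a *: x + y)) =
               (fun f : dual => a *: f x + f y)); last first.
    by apply/funext => f; rewrite linearP.
  by apply: cvgD; [apply: cvgZl_tmp|]; exact: lE.
have near_l e : 0 < e ->
    F [set f : dual | forall x, `|f x - l x| <= e * `|x|].
  move=> e0; apply: filterS (cauchy_near_near FF Fc e0) => f fF x.
  apply: (cvg_dist_le _ (lE x)); apply: filterS fF => h /ltW fh.
  by apply: le_trans (dual_opnormP (f - h)%R x) _; rewrite ler_wpM2r.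
pose ln : {linear V -> R^o} :=
  HB.pack l (GRing.isLinear.Build R V R^o _ l ll).
have lc : continuous (l : V -> R^o).
  apply: (@bounded_linear_continuous _ _ _ ln); apply/linear_boundedP.
  have [f fl] := filter_ex (near_l 1 ltr01).
  near=> M => x; rewrite -[ln x](subrK (f x)).
  apply: le_trans (ler_normD _ _) _; rewrite distrC.
  apply: le_trans (lerD (fl x) (dual_opnormP f x)) _.
  by rewrite -mulrDl ler_wpM2r//; near: M; exact: nbhs_pinfty_ge.
have lP : dual_pred l by apply/asboolP.
apply/cvg_ex; exists (Dual lP); apply/cvgrPdist_le => e e0.
apply: filterS (near_l e e0) => f fl; rewrite distrC.
by apply: (@dual_opnorm_le (f - Dual lP)%R); [exact: ltW|exact: fl].
Unshelve. all: by end_near. Qed.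

HB.instance Definition _ := Uniform_isComplete.Build dual dual_cauchy_cvg.

End dual_space.

Section l2_direct_sum.
Variables (R : realType) (Y : nat -> completeNormedModType R).

Definition l2_family : Type := forall n, Y n.
Identity Coercion l2_family_fun : l2_family >-> Funclass.
Implicit Types x y : l2_family.

HB.instance Definition _ := gen_eqMixin l2_family.
HB.instance Definition _ := gen_choiceMixin l2_family.

Let l2_family_ext x y : (forall n, x n = y n) -> x = y.
Proof. exact: functional_extensionality_dep. Qed.

Definition l2_family_zero : l2_family := fun n => 0.
Definition l2_family_opp x : l2_family := fun n => - x n.
Definition l2_family_add x y : l2_family := fun n => x n + y n.
Definition l2_family_scale (a : R) x : l2_family := fun n => a *: x n.

Let l2_family_addA : associative l2_family_add.
Proof. by move=> x y z; apply: l2_family_ext => n; exact: addrA. Qed.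
Let l2_family_addC : commutative l2_family_add.
Proof. by move=> x y; apply: l2_family_ext => n; exact: addrC. Qed.
Let l2_family_add0 : left_id l2_family_zero l2_family_add.
Proof. by move=> x; apply: l2_family_ext => n; exact: add0r. Qed.
Let l2_family_addN : left_inverse l2_family_zero l2_family_opp l2_family_add.
Proof. by move=> x; apply: l2_family_ext => n; exact: addNr. Qed.

HB.instance Definition _ :=
  GRing.isZmodule.Build l2_family
    l2_family_addA l2_family_addC l2_family_add0 l2_family_addN.

Let l2_family_scaleA a b x :
  l2_family_scale a (l2_family_scale b x) = l2_family_scale (a * b) x.
Proof. by apply: l2_family_ext => n; exact: scalerA. Qed.
Let l2_family_scale1 : left_id 1 l2_family_scale.
Proof. by move=> x; apply: l2_family_ext => n; exact: scale1r. Qed.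
Let l2_family_scaleDr : right_distributive l2_family_scale +%R.
Proof. by move=> a x y; apply: l2_family_ext => n; exact: scalerDr. Qed.
Let l2_family_scaleDl x : {morph l2_family_scale^~ x : a b / a + b}.
Proof. by move=> a b; apply: l2_family_ext => n; exact: scalerDl. Qed.

HB.instance Definition _ := GRing.Zmodule_isLmodule.Build R l2_family
  l2_family_scaleA l2_family_scale1 l2_family_scaleDr l2_family_scaleDl.

Definition l2_pred : {pred l2_family} :=
  fun x => `[< cvgn [series `|x n| ^+ 2]_n >].

Record l2sum := L2sum { l2_val :> l2_family ; l2P : l2_pred l2_val }.

HB.instance Definition _ := [isSub for l2_val].
HB.instance Definition _ := gen_eqMixin l2sum.
HB.instance Definition _ := gen_choiceMixin l2sum.

Definition l2norm (x : l2sum) : R := Num.sqrt (limn [series `|x n| ^+ 2]_n).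

Let psum x N : R := \sum_(0 <= n < N) `|x n| ^+ 2.

Let psum_ge0 x N : 0 <= psum x N.
Proof. by apply: sumr_ge0 => n _; rewrite exprn_ge0. Qed.

Let psum_nd x : nondecreasing_seq (psum x).
Proof.
apply/nondecreasing_seqP => n.
by rewrite /psum big_nat_recr//= lerDl exprn_ge0.
Qed.

Let psum_coord x n : `|x n| ^+ 2 <= psum x n.+1.
Proof. by rewrite /psum big_nat_recr//= lerDr psum_ge0. Qed.

Let plane_triangle (a b c d : R) : 0 <= a -> 0 <= b -> 0 <= c -> 0 <= d ->
  Num.sqrt ((a + b) ^+ 2 + (c + d) ^+ 2) <=
  Num.sqrt (a ^+ 2 + c ^+ 2) + Num.sqrt (b ^+ 2 + d ^+ 2).
Proof.
move=> a0 b0 c0 d0.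
set s := Num.sqrt (a ^+ 2 + c ^+ 2); set t := Num.sqrt (b ^+ 2 + d ^+ 2).
have s0 : 0 <= s by exact: sqrtr_ge0.
have t0 : 0 <= t by exact: sqrtr_ge0.
have sE : s ^+ 2 = a ^+ 2 + c ^+ 2 by rewrite sqr_sqrtr ?addr_ge0 ?sqr_ge0.
have tE : t ^+ 2 = b ^+ 2 + d ^+ 2 by rewrite sqr_sqrtr ?addr_ge0 ?sqr_ge0.
have st : a * b + c * d <= s * t.
  rewrite -ler_sqr ?nnegrE ?addr_ge0 ?mulr_ge0// exprMn sE tE -subr_ge0.
  rewrite (_ : _ - _ = (a * d - b * c) ^+ 2) ?sqr_ge0//; ring.
rewrite -[leRHS]ger0_norm ?addr_ge0// -sqrtr_sqr; apply: ler_wsqrtr.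
rewrite sqrrD (sqrrD s) sqrrD sE tE.
rewrite -subr_ge0 (_ : _ - _ = (s * t - (a * b + c * d)) *+ 2); last by ring.
by rewrite mulrn_wge0// subr_ge0.
Qed.

Let psumD x y N : Num.sqrt (psum (x + y) N) <=
  Num.sqrt (psum x N) + Num.sqrt (psum y N).
Proof.
elim: N => [|N ih]; first by rewrite /psum !big_geq// sqrtr0 addr0.
have psumS z : psum z N.+1 = Num.sqrt (psum z N) ^+ 2 + `|z N| ^+ 2.
  by rewrite sqr_sqrtr// /psum big_nat_recr.
rewrite !psumS.
apply: le_trans (plane_triangle _ _ _ _); rewrite ?sqrtr_ge0//.
rewrite ler_sqrt ?addr_ge0 ?sqr_ge0//.
apply: lerD; rewrite lerXn2r ?nnegrE ?addr_ge0 ?sqrtr_ge0//.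
exact: ler_normD.
Qed.

Let psumZ a x N : psum (a *: x) N = `|a| ^+ 2 * psum x N.
Proof.
rewrite /psum mulr_sumr; apply: eq_bigr => n _.
by rewrite -exprMn -normrZ.
Qed.

Let l2_predP x : reflect (exists M, forall N, psum x N <= M) (l2_pred x).
Proof.
apply: (iffP (asboolP _)) => [cx|[M xM]].
  by exists (limn (psum x)) => N; exact: nondecreasing_cvgn_le.
apply: nondecreasing_is_cvgn; first exact: psum_nd.
by exists M; apply/ubP => _ [N _ <-]; exact: xM.
Qed.

Lemma l2_submod : submod_closed l2_pred.
Proof.
split.
  apply/l2_predP; exists 0 => N; rewrite /psum big1// => n _.
  by rewrite normr0 expr0n.
move=> a x y /l2_predP[A xA] /l2_predP[B yB]; apply/l2_predP.
exists ((Num.sqrt (`|a| ^+ 2 * A) + Num.sqrt B) ^+ 2) => N.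
rewrite -[psum _ _]sqr_sqrtr// lerXn2r ?nnegrE ?addr_ge0 ?sqrtr_ge0//.
apply: le_trans (psumD _ _ _) _.
by apply: lerD; apply: ler_wsqrtr => //; rewrite psumZ ler_wpM2l ?exprn_ge0.
Qed.

HB.instance Definition _ := GRing.isSubmodClosed.Build R l2_family l2_pred
  l2_submod.
HB.instance Definition _ := [SubChoice_isSubLmodule of l2sum by <:].

Implicit Types u v : l2sum.

Let l2norm_ge0 u : 0 <= l2norm u. Proof. exact: sqrtr_ge0. Qed.

Let cvg_psum u : cvgn (psum u).
Proof. by case: u => x /= /asboolP. Qed.

Let psum_le u N : psum u N <= l2norm u ^+ 2.
Proof.
have uN : psum u N <= limn (psum u) by apply: nondecreasing_cvgn_le.
by rewrite sqr_sqrtr// (le_trans _ uN).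
Qed.

Let l2norm_le u M : 0 <= M -> (forall N, psum u N <= M ^+ 2) -> l2norm u <= M.
Proof.
move=> M0 uM; rewrite -[leRHS]ger0_norm// -sqrtr_sqr; apply: ler_wsqrtr.
by apply: limr_le; [exact: cvg_psum|exact: nearW].
Qed.

Lemma l2_coord_le u n : `|u n| <= l2norm u.
Proof.
by rewrite -ler_sqr ?nnegrE// (le_trans (psum_coord u n)).
Qed.

Let l2_normD u v : l2norm (u + v) <= l2norm u + l2norm v.
Proof.
apply: l2norm_le => [|N]; first by rewrite addr_ge0.
rewrite -[psum _ _]sqr_sqrtr// lerXn2r ?nnegrE ?addr_ge0 ?sqrtr_ge0//.
apply: le_trans (psumD u v N) _; apply: lerD.
  by rewrite -[leRHS]ger0_norm// -sqrtr_sqr; apply: ler_wsqrtr.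
by rewrite -[leRHS]ger0_norm// -sqrtr_sqr; apply: ler_wsqrtr.
Qed.

Let l2_normZ (a : R) u : l2norm (a *: u) = `|a| * l2norm u.
Proof.
have H (b : R) v : l2norm (b *: v) <= `|b| * l2norm v.
  apply: l2norm_le => [|N]; first by rewrite mulr_ge0.
  by rewrite (psumZ b v) exprMn ler_wpM2l ?exprn_ge0.
apply/eqP; rewrite eq_le H andTb.
have [->|a0] := eqVneq a 0; first by rewrite normr0 mul0r.
rewrite -ler_pdivlMl ?normr_gt0//.
by have := H a^-1 (a *: u); rewrite scalerA mulVf// scale1r normfV.
Qed.

Let l2_norm_eq0 u : l2norm u = 0 -> u = 0.
Proof.
move=> u0; apply: val_inj; apply: l2_family_ext => n; apply/eqP.
by rewrite -normr_le0; have := l2_coord_le u n; rewrite u0.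
Qed.

HB.instance Definition _ := Lmodule_isNormed.Build R l2sum
  l2_normD l2_normZ l2_norm_eq0.

Lemma l2_cauchy_cvg (F : set_system l2sum) :
  ProperFilter F -> cauchy F -> cvg F.
Proof.
move=> FF Fc.
have lE n : cvg ((fun u : l2sum => u n) @ F).
  apply: (@cauchy_lipschitz_cvg _ _ _ _ _ 1) => // u v.
  by rewrite mul1r; exact: (l2_coord_le (u - v)%R n).
pose l : l2_family := fun n => lim ((fun u : l2sum => u n) @ F).
have psum_cvg u N : (fun v : l2sum => psum (u - v)%R N) @ F --> psum (l2_val u - l) N.
  elim: N => [|N ih].
    rewrite /psum big_geq//; under eq_fun do rewrite big_geq//.
    exact: cvg_cst.
  rewrite /psum big_nat_recr//=; under eq_fun do rewrite big_nat_recr//=.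
  apply: cvgD; first exact: ih.
  by apply: cvgM; apply: cvg_norm; apply: cvgB; [exact: cvg_cst|exact: lE
    |exact: cvg_cst|exact: lE].
have near_l e : 0 < e ->
    F [set u : l2sum | forall N, psum (l2_val u - l) N <= e ^+ 2].
  move=> e0; apply: filterS (cauchy_near_near FF Fc e0) => u uF N.
  apply: (cvgr_to_le (psum_cvg u N)); apply: filterS uF => v /ltW uv.
  apply: le_trans (psum_le (u - v)%R N) _.
  by rewrite lerXn2r ?nnegrE// ltW.
have lP : l2_pred l.
  have [u ul] := filter_ex (near_l 1 ltr01).
  have ulP : l2_val u - l \in l2_pred by apply/l2_predP; exists (1 ^+ 2).
  have := rpredB (l2P u : l2_val u \in l2_pred) ulP.
  by rewrite opprB addrC subrK.
apply/cvg_ex; exists (L2sum lP); apply/cvgrPdist_le => e e0.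
apply: filterS (near_l e e0) => u ul; rewrite distrC.
by apply: (@l2norm_le (u - L2sum lP)%R); [exact: ltW|exact: ul].
Qed.

HB.instance Definition _ := Uniform_isComplete.Build l2sum l2_cauchy_cvg.

End l2_direct_sum.

Section spaces.
Variable R : realType.
Implicit Types (X Y Z A B E F : completeNormedModType R).

Definition separable X : Prop := exists2 D : set X, countable D & dense D.

Definition reflexive_space X : Prop :=
  forall phi : dual (dual X), exists x : X, forall f : dual X, phi f = f x.

Definition l2_power X : completeNormedModType R := l2sum (fun=> X).

(* Classes of Banach spaces; all those considered below are invariant under
   linear isometries, and "A is a subspace of X" is rendered by a linear
   isometric embedding of A into X. *)
Definition space_class : Type := completeNormedModType R -> Prop.
Implicit Types K C : space_class.

Definition has_dim (n : nat) A : Prop :=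
  exists f : {linear A -> 'rV[R]_n}, bijective f.

Definition finite_dim A : Prop := exists n, has_dim n A.

Definition fin_rep X Y : Prop :=
  forall e : R, 0 < e -> forall A, finite_dim A ->
  forall j : {linear A -> X}, isometric j ->
  exists2 u : {linear A -> Y}, iso_embedding u & distortion u <= 1 + e.

Definition fin_equiv X Y : Prop := fin_rep X Y /\ fin_rep Y X.

Definition fclass X : space_class := fun Y => fin_equiv X Y.

Definition fin_rep_in C X : Prop := exists2 Y, C Y & fin_rep X Y.

Definition superreflexive C : Prop := forall Y, C Y -> reflexive_space Y.

(* Used only for spaces of the same finite dimension (inf set0 is 0). *)
Definition bm_dist A B : R :=
  inf [set distortion u | u in [set u : {linear A -> B} | isomorphism u]].

(* Distance less than e in the disjoint union of the metric spaces of
   n-dimensional spaces. *)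
Definition bm_near (e : R) A B : Prop :=
  exists n, [/\ has_dim n A, has_dim n B & ln (bm_dist A B) < e].

Definition bm_closure K : space_class :=
  fun A => forall e, 0 < e -> exists2 B, K B & bm_near e A B.

Definition fd_subspaces X : space_class :=
  fun A => finite_dim A /\ exists j : {linear A -> X}, isometric j.

Definition minkowski_base X : space_class := bm_closure (fd_subspaces X).

Definition subspaces_of K : space_class :=
  fun A => exists2 B, K B & exists j : {linear A -> B}, isometric j.

(* q induces a linear isometry from B / ker q, with the quotient norm
   |b + ker q| = inf |b - z| over z in ker q, onto A. *)
Definition quotients_of K : space_class :=
  fun A => exists2 B, K B & exists q : {linear B -> A},
    (forall a, exists b, q b = a) /\
    forall b, `|q b| = inf [set `|b - z| | z in [set z | q z = 0]].

Definition starstar X : space_class := fun Y =>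
  forall A, minkowski_base Y A <->
    subspaces_of (quotients_of (minkowski_base (l2_power X))) A.

Definition starstar_closed C : Prop := exists Y, forall X, C X <-> starstar Y X.

Definition bm_dense_seq (Y : nat -> completeNormedModType R) K : Prop :=
  (forall n, K (Y n)) /\
  forall A, K A -> forall e, 0 < e -> exists n, bm_near e A (Y n).

(* The class obtained from X by the star procedure is star_class Y for any
   Y such that bm_dense_seq Y (minkowski_base (l2_power X)). *)
Definition star_class (Y : nat -> completeNormedModType R) : space_class :=
  fclass (dual (l2sum Y)).

Definition almost_universal_disposition K E : Prop :=
  forall A B, K A -> K B -> forall j : {linear A -> B}, isometric j ->
  forall e : R, 0 < e ->
  forall i : {linear A -> E}, iso_embedding i ->
  exists i' : {linear B -> E},
    [/\ iso_embedding i', forall a, i' (j a) = i a &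
        distortion i' <= (1 + e) * distortion i].

Definition couniversal E K : Prop :=
  forall F, K F -> exists q : {linear E -> F},
    continuous q /\ forall y, exists x, q x = y.

End spaces.

(* Main.v *)
Require Import Defs.
From HB Require Import structures.
From mathcomp Require Import all_boot all_order all_algebra.
From mathcomp Require Import all_classical all_reals all_analysis.
From mathcomp Require Import finmap ring lra.

Set Implicit Arguments.
Unset Strict Implicit.
Unset Printing Implicit Defensive.

Import Order.TTheory GRing.Theory Num.Theory.
Import numFieldNormedType.Exports.

Local Open Scope classical_set_scope.
Local Open Scope ring_scope.

(* Write M(X) for the Minkowski base of X, and call V an almost subquotient of H
   when for every e > 0 it is (1 + e)-close to a quotient of a linear subspace of
   H. This relation is transitive and stable under l2-sums. If W is a space with
   M(X) = HQ M(l2(W)), then a finite-dimensional A belongs to M(X) if and only if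
   it is an almost subquotient of l2(W); hence so is Z = l2sum Y.

   Let F be separable and finitely representable in Z^*. By Goldstine's theorem
   the finite-dimensional subspaces of F^* are almost subquotients of Z, hence
   belong to M(X). It follows that the l2-sum of F^* and copies of X is finitely
   equivalent to X, so it is reflexive, and so are F^* and F.

   Let S be the span of a sequence in F^* that norms a dense sequence of F. Almost
   universal disposition, applied along the finite-dimensional subspaces
   spanned by initial segments, gives an isomorphic embedding u of S into E_X.
   For g in (E_X)^* the functional g o u on S extends to F^*, hence is evaluation
   at a point q(g) of F; it determines q(g) because S separates the points of F.
   Every y in F is reached, since y o u^-1 extends from u(S) to E_X. *)

(** * Linear extensions *)

Section linear_sets.
Variables (R : realType) (V : lmodType R).

Definition linear_set (S : set V) : Prop :=
  S 0 /\ forall a x y, S x -> S y -> S (a *: x + y).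

Definition linear_on (W : lmodType R) (S : set V) (f : V -> W) : Prop :=
  forall a x y, S x -> S y -> f (a *: x + y) = a *: f x + f y.

Lemma linear_setZ S a x : linear_set S -> S x -> S (a *: x).
Proof. by case=> S0 lS Sx; rewrite -[_ *: _]addr0; exact: lS. Qed.

Lemma linear_setB S x y : linear_set S -> S x -> S y -> S (x - y).
Proof. by case=> S0 lS Sx Sy; rewrite addrC -scaleN1r; exact: lS. Qed.

Lemma linear_setD S x y : linear_set S -> S x -> S y -> S (x + y).
Proof. by case=> S0 lS Sx Sy; rewrite -[x]scale1r; exact: lS. Qed.

End linear_sets.

Section hahn_banach.
Variables (R : realType) (V : lmodType R) (p : V -> R).
Hypothesis pD : forall x y, p (x + y) <= p x + p y.
Hypothesis pZ : forall a x, p (a *: x) = `|a| * p x.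

Let dom (G : set (V * R^o)) := forall v, G v -> v.2 <= p v.1.

Let p0 : p 0 = 0.
Proof. by rewrite -(scale0r 0) pZ normr0 mul0r. Qed.

Let pN x : p (- x) = p x.
Proof. by rewrite -scaleN1r pZ normrN normr1 mul1r. Qed.

Let dom_fun G x r s : linear_set G -> dom G -> G (x, r) -> G (x, s) -> r = s.
Proof.
move=> lG dG Gr Gs.
have /dG := linear_setB lG Gr Gs; have /dG := linear_setB lG Gs Gr.
by rewrite /= subrr p0 !subr_le0 => rs sr; apply/eqP; rewrite eq_le sr rs.
Qed.

(* c is admissible as the value at x of an extension of G when it lies between
   all the r - p (v - x) and all the p (v + x) - r. *)
Let extend G x : linear_set G -> dom G ->
  exists G', [/\ linear_set G', dom G', G `<=` G' & exists c, G' (x, c)].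
Proof.
move=> lG dG.
pose E := [set v.2 - p (v.1 - x) | v in G].
have Eub v w : G v -> G w -> v.2 - p (v.1 - x) <= p (w.1 + x) - w.2.
  move=> Gv Gw; have /= := dG _ (linear_setD lG Gv Gw).
  have -> : v.1 + w.1 = (v.1 - x) + (w.1 + x) by rewrite [w.1 + x]addrC addrA subrK.
  by move/le_trans/(_ (pD _ _)); lra.
have [G0 _] := lG.
have hE : has_sup E.
  split; first by exists (0 - p (0 - x)), 0.
  by exists (p (0 + x) - 0) => _ [v Gv <-]; exact: (Eub v 0).
pose c := sup E.
have cl v : G v -> v.2 - c <= p (v.1 - x).
  move=> Gv; rewrite lerBlDr -lerBlDl.
  by apply: (ub_le_sup hE.2); exists v.
have cr v : G v -> v.2 + c <= p (v.1 + x).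
  move=> Gv; rewrite -lerBrDl; apply: ge_sup; first exact: hE.1.
  by move=> _ [w Gw <-]; exact: Eub.
exists [set vt | exists v t, G v /\ vt = (v.1 + t *: x, v.2 + t * c)].
split.
- split; first by exists 0, 0; rewrite scale0r mul0r !addr0.
  move=> a _ _ [v [t [Gv ->]]] [w [s [Gw ->]]].
  exists (a *: v + w), (a * t + s); split; first exact: lG.2.
  congr pair => /=; first by rewrite scalerDr scalerDl scalerA addrACA.
  rewrite /GRing.scale/=; ring.
- move=> _ [v [t [Gv ->]]] /=.
  have [->|t0] := eqVneq t 0; first by rewrite scale0r mul0r !addr0; exact: dG.
  have [tp|tn] := ltP 0 t.
    have -> : p (v.1 + t *: x) = t * p (t^-1 *: v.1 + x).
      by rewrite -{2}(gtr0_norm tp) -pZ scalerDr scalerA mulfV// scale1r.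
    have /cr := linear_setZ t^-1 lG Gv; rewrite -(ler_pM2l tp) mulrDr.
    by rewrite /= /GRing.scale/= mulrA mulfV// mul1r.
  have tn' : 0 < - t by rewrite oppr_gt0 lt_neqAle t0.
  have -> : p (v.1 + t *: x) = - t * p ((- t)^-1 *: v.1 - x).
    rewrite -{1}(gtr0_norm tn') -pZ scalerBr scalerA mulfV ?oppr_eq0//.
    by rewrite scale1r scaleNr opprK.
  have /cl := linear_setZ (- t)^-1 lG Gv; rewrite -(ler_pM2l tn') mulrBr.
  by rewrite /= /GRing.scale/= mulrA mulfV ?oppr_eq0// mul1r (mulNr t c) opprK.
- by move=> v Gv; exists v, 0; rewrite scale0r mul0r !addr0; case: v Gv.
- by exists c, 0, 1; rewrite /= !add0r scale1r mul1r.
Qed.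

Lemma hahn_banach (S : set V) (f : V -> R^o) :
  linear_set S -> linear_on S f -> (forall x, S x -> f x <= p x) ->
  exists g : {linear V -> R^o},
    (forall x, S x -> g x = f x) /\ forall x, `|g x| <= p x.
Proof.
move=> lS lf fp.
pose G0 : set (V * R^o) := [set v | S v.1 /\ v.2 = f v.1].
pose P (G : set (V * R^o)) := linear_set (G `|` G0) /\ dom (G `|` G0).
have f0 : f 0 = 0.
  by have := lf 1 0 0 lS.1 lS.1; rewrite scaler0 addr0 scale1r -[LHS]addr0 => /addrI.
have lG0 : linear_set G0.
  split; first by split; [exact: lS.1|rewrite /= f0].
  move=> a [x r] [y s] [/= Sx ->] [/= Sy ->]; split=> /=; first exact: lS.2.
  by rewrite lf.
have [F FP Ftot|G [[lG dG] Gmax]] := @Zorn_bigcup _ P.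
  split.
    split; first by right; exact: lG0.1.
    move=> a x y.
    have cup H : F H -> H `|` G0 `<=` \bigcup_(X in F) X `|` G0.
      by move=> FH z [Hz|G0z]; [left; exists H|right].
    have sub H z : F H -> P H by move=> /FP.
    case=> [[H1 F1 H1x]|G0x]; case=> [[H2 F2 H2y]|G0y].
    - have [H12|H21] := Ftot _ _ F1 F2.
        apply: (cup _ F2); apply: (FP _ F2).1.2; left => //; exact: H12.
      by apply: (cup _ F1); apply: (FP _ F1).1.2; left => //; exact: H21.
    - by apply: (cup _ F1); apply: (FP _ F1).1.2; [left|right].
    - by apply: (cup _ F2); apply: (FP _ F2).1.2; [right|left].
    - by right; exact: lG0.2.
  move=> v [[H FH Hv]|[Sv ->]]; last exact: fp.
  by apply: (FP _ FH).2; left.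
pose H := G `|` G0.
have Hall x : exists c, H (x, c).
  have [G' [lG' dG' GG' [c G'c]]] := @extend H x lG dG.
  suff -> : H = G' by exists c.
  have G0G' : G' `|` G0 = G'.
    by apply/setUidPl => v Hv; apply: GG'; right.
  apply/seteqP; split=> // v G'v; left; apply: contrapT => Gv.
  apply: (Gmax G'); last by rewrite /P G0G'.
  by split=> [w Gw|G'G]; [apply: GG'; left|exact/Gv/G'G].
have [g Hg] := choice Hall.
have gl : linear g.
  move=> a x y; apply: (dom_fun lG dG (Hg _)).
  exact: (lG.2 a _ _ (Hg x) (Hg y)).
pose gL : {linear V -> R^o} := HB.pack g (GRing.isLinear.Build R V R^o _ g gl).
exists gL; split=> x; last first.
  rewrite ler_norml (dG _ (Hg x)) andbT lerNl.
  by rewrite -[- gL x]linearN -(pN x); exact: (dG _ (Hg (- x))).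
by move=> Sx; apply: (dom_fun lG dG (Hg _)); right.
Qed.

End hahn_banach.

Section dual_extension.
Variables (R : realType) (V : normedModType R).
Implicit Types (S : set V) (f : dual V).

Lemma dual_norm_le f M : 0 <= M -> (forall x, `|f x| <= M * `|x|) -> `|f| <= M.
Proof. exact: dual_opnorm_le. Qed.

Lemma dual_le_norm f x : `|f x| <= `|f| * `|x|.
Proof. exact: dual_opnormP. Qed.

Lemma dual_of_bounded (g : {linear V -> R^o}) M :
  (forall x, `|g x| <= M * `|x|) -> exists f : dual V, forall x, f x = g x.
Proof.
move=> gM.
have cg : continuous g.
  apply: bounded_linear_continuous; apply/linear_boundedP.
  exists M; split; first exact: num_real.
  by move=> N MN x; apply: le_trans (gM x) _; rewrite ler_wpM2r// ltW.
have gP : dual_pred g by apply/asboolP; split=> //; exact: linearP.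
by exists (Dual gP).
Qed.

Lemma dual_extension S (f : V -> R^o) M : 0 <= M -> linear_set S ->
  linear_on S f -> (forall x, S x -> `|f x| <= M * `|x|) ->
  exists2 g : dual V, forall x, S x -> g x = f x & `|g| <= M.
Proof.
move=> M0 lS lf fM.
have [|a x|x Sx|g [gf gM]] := @hahn_banach R V (fun x => M * `|x|) _ _ S f lS lf.
- by move=> x y; rewrite -mulrDr ler_wpM2l// ler_normD.
- by rewrite normrZ mulrCA.
- by apply: le_trans (fM x Sx); exact: ler_norm.
have [h hg] := dual_of_bounded gM.
exists h => [x Sx|]; first by rewrite hg gf.
by apply: dual_norm_le => // x; rewrite hg.
Qed.

Lemma dual_separation (N : set V) (x : V) d : linear_set N -> 0 < d ->
  (forall z, N z -> d <= `|x - z|) ->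
  exists f : dual V, [/\ forall z, N z -> f z = 0, f x = d & `|f| <= 1].
Proof.
move=> lN d0 xN; pose S := [set v | exists t, N (v - t *: x)].
have Nx : ~ N x by move=> /xN; rewrite subrr normr0; lra.
have uniq v t s : N (v - t *: x) -> N (v - s *: x) -> t = s.
  move=> Nt Ns; apply: contrapT => /eqP; rewrite -subr_eq0 => ts0; apply: Nx.
  have := linear_setZ (t - s)^-1 lN (linear_setB lN Ns Nt).
  have -> : v - s *: x - (v - t *: x) = (t - s) *: x.
    by rewrite scalerBl opprB addrC addrA subrK.
  by rewrite scalerA mulVf// scale1r.
pose c (v : V) : R := xget 0 [set t | N (v - t *: x)].
have cE v t : N (v - t *: x) -> c v = t.
  move=> Nt; rewrite /c; case: xgetP => [s _ /= Ns|/(_ t)/=]; last by [].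
  exact: uniq Ns Nt.
have [||v [t Nt]|g gf g1] := @dual_extension S (fun v => d * c v : R^o) 1 ler01.
- split; first by exists 0; rewrite scale0r subr0; exact: lN.1.
  move=> a v w [t Nt] [s Ns]; exists (a * t + s).
  by rewrite scalerDl -scalerA opprD addrACA -scalerBr; exact: lN.2.
- move=> a v w [t Nt] [s Ns].
  rewrite (cE v t)// (cE w s)// (cE _ (a * t + s)); first by rewrite /GRing.scale/=; ring.
  rewrite scalerDl -scalerA opprD addrACA -scalerBr.
  exact: lN.2.
- rewrite (cE v t)// mul1r normrM (gtr0_norm d0).
  have [->|t0] := eqVneq t 0; first by rewrite normr0 mulr0.
  have Nz : N (- t^-1 *: (v - t *: x)) by exact: linear_setZ.
  rewrite mulrC -ler_pdivlMl ?normr_gt0//; apply: le_trans (xN _ Nz) _.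
  rewrite scaleNr opprK scalerBr scalerA mulVf// scale1r addrC subrK.
  by rewrite normrZ normfV.
exists g; split=> // [z Nz|].
  have Sz : N (z - 0 *: x) by rewrite scale0r subr0.
  by rewrite gf; [rewrite (cE z 0)// mulr0|exists 0].
have Sx : N (x - 1 *: x) by rewrite scale1r subrr; exact: lN.1.
by rewrite gf; [rewrite (cE x 1)// mulr1|exists 1].
Qed.

Lemma dual_norming (x : V) : exists2 f : dual V, f x = `|x| & `|f| <= 1.
Proof.
have [->|x0] := eqVneq x 0.
  by exists 0; rewrite ?linear0 ?normr0.
have [||_ ->|f [_ fx f1]] := @dual_separation [set 0] x `|x|.
- by split=> // a _ _ -> ->; rewrite scaler0 addr0.
- by rewrite normr_gt0.
- by rewrite subr0.
- by exists f.
Qed.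

Lemma dual_almost_norming f (e : R) : 0 < e ->
  exists2 x, `|x| <= 1 & `|f| - e <= `|f x|.
Proof.
move=> e0; apply: contrapT => H.
have fx x : `|x| <= 1 -> `|f x| < `|f| - e.
  by move=> x1; rewrite ltNge; apply/negP => fx; apply: H; exists x.
have M0 : 0 < `|f| - e by have := fx 0; rewrite linear0 !normr0; apply.
suff : `|f| <= `|f| - e by lra.
apply: dual_norm_le => [|x]; first exact: ltW.
have [->|x0] := eqVneq x 0; first by rewrite linear0 !normr0 mulr0.
rewrite mulrC -ler_pdivrMl ?normr_gt0//.
have := fx (`|x|^-1 *: x); rewrite linearZ normrZ normfV normr_id.
by rewrite mulVf ?normr_eq0// lexx => /(_ isT)/ltW; rewrite normrZ normfV normr_id.
Qed.

End dual_extension.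

(** * Finite-dimensional spaces *)

Section seminorms.
Variables (R : realType) (V : lmodType R) (p : V -> R).

Definition seminorm_axiom :=
  (forall x y, p (x + y) <= p x + p y) /\ forall a x, p (a *: x) = `|a| * p x.

Hypothesis sp : seminorm_axiom.

Lemma seminorm0 : p 0 = 0.
Proof. by rewrite -(scale0r 0) sp.2 normr0 mul0r. Qed.

Lemma seminormN x : p (- x) = p x.
Proof. by rewrite -scaleN1r sp.2 normrN normr1 mul1r. Qed.

Lemma seminorm_ge0 x : 0 <= p x.
Proof. by have := sp.1 x (- x); rewrite subrr seminorm0 seminormN; lra. Qed.

Lemma seminorm_dist x y : `|p x - p y| <= p (x - y).
Proof.
have H u v : p u <= p (u - v) + p v by rewrite -{1}(subrK v u) sp.1.
rewrite ler_norml; apply/andP; split; last by have := H x y; lra.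
by have := H y x; rewrite -[y - x]opprB seminormN; lra.
Qed.

End seminorms.

Lemma seminorm_comp (R : realType) (V : lmodType R) (W : normedModType R)
  (u : {linear V -> W}) : seminorm_axiom (fun x => `|u x|).
Proof.
by split=> [x y|a x]; rewrite ?linearD ?linearZ ?normrZ ?ler_normD.
Qed.

Section row_norms.
Variables (R : realType) (n : nat) (p : 'rV[R]_n -> R).
Hypothesis sp : seminorm_axiom p.

Lemma row_coord_le (x : 'rV[R]_n) j : `|x 0 j| <= `|x|.
Proof.
rewrite [leRHS]/Num.norm /= mx_normrE; apply/bigmax_geP; right.
by exists (0, j).
Qed.

Lemma seminorm_row_le : exists2 C, 0 < C & forall x, p x <= C * `|x|.
Proof.
exists (1 + \sum_(j < n) p (delta_mx 0 j)) => [|x].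
  by rewrite ltr_pwDl// sumr_ge0// => j _; exact: seminorm_ge0.
rewrite {1}[x]row_sum_delta mulrDl mul1r ler_wpDl// mulr_suml.
elim/big_ind2 : _ => [|u a v b ua vb|j _]; first by rewrite seminorm0.
  by rewrite (le_trans (sp.1 _ _))// lerD.
by rewrite sp.2 mulrC ler_wpM2l ?row_coord_le// seminorm_ge0.
Qed.

Lemma seminorm_row_continuous : continuous p.
Proof.
have [C C0 pC] := seminorm_row_le.
move=> x; apply/(@cvgrPdist_lt _ _ _ (nbhs (x : 'rV[R]_n))) => e e0.
apply/nbhs_ballP; exists (e / C) => [|y]; first exact: divr_gt0.
rewrite -ball_normE /= ltr_pdivlMr// mulrC; apply: le_lt_trans.
exact: le_trans (seminorm_dist sp _ _) (pC _).
Qed.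

Lemma norm_row_ge : (forall x, p x = 0 -> x = 0) ->
  exists2 c, 0 < c & forall x, c * `|x| <= p x.
Proof.
move=> p0; pose S := [set x : 'rV[R]_n | `|x| = 1].
have normS x : x != 0 -> S (`|x|^-1 *: x).
  move=> x0; rewrite /S/= normrZ normfV normr_id mulVf//.
  by rewrite normr_eq0.
have [S0|/set0P/negP/negPn/eqP S0] := pselect (S !=set0); last first.
  exists 1 => // x; have [->|x0] := eqVneq x 0.
    by rewrite normr0 mulr0 seminorm_ge0.
  by have := normS x x0; rewrite S0.
have cS : compact S.
  apply: bounded_closed_compact.
    exists 1; split; first exact: num_real.
    by move=> M M1 x /= ->; exact: ltW.
  have -> : S = (fun x : 'rV[R]_n => `|x|) @^-1` [set 1] by [].
  apply: preimage_closed; last exact: closed_eq.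
  move=> x _. exact: norm_continuous.
have [|c /set_mem Sc cmin] := compact_EVT_min (f := p) S0 cS.
  by apply: continuous_subspaceT; exact: seminorm_row_continuous.
have pc0 : 0 < p c.
  rewrite lt_neqAle eq_sym seminorm_ge0// andbT; apply/eqP => /p0 c0.
  by move: Sc; rewrite /S /= c0 normr0 => /esym/eqP; rewrite oner_eq0.
exists (p c) => // x.
have [->|x0] := eqVneq x 0; first by rewrite normr0 mulr0 seminorm_ge0.
have /mem_set/cmin := normS x x0.
by rewrite sp.2 normfV normr_id ler_pdivlMl ?normr_gt0// mulrC.
Qed.

Hypothesis p0 : forall x, p x = 0 -> x = 0.

(* The vacuous binding makes the type depend on p, so that the norm p can be
   attached to it instead of the standard norm of row vectors. *)
Definition row_space : Type := let _ := (sp, p0) in 'rV[R]_n.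

HB.instance Definition _ := GRing.Lmodule.on row_space.
HB.instance Definition _ := Lmodule_isNormed.Build R row_space sp.1 sp.2 p0.

Lemma row_space_cauchy_cvg (F : set_system row_space) :
  ProperFilter F -> cauchy F -> cvg F.
Proof.
move=> FF Fc.
have [c c0 pc] := norm_row_ge p0; have [C C0 pC] := seminorm_row_le.
have cvF j : cvg ((fun x : row_space => (x : 'rV[R]_n) 0 j : R^o) @ F).
  apply: (@cauchy_lipschitz_cvg _ _ _ _ _ c^-1) => // x y.
  rewrite ler_pdivlMl//; apply: le_trans (pc _); rewrite ler_pM2l//.
  by have := row_coord_le ((x : 'rV[R]_n) - y) j; rewrite !mxE.
pose l : 'rV[R]_n := \row_j lim ((fun x : row_space => (x : 'rV[R]_n) 0 j : R^o) @ F).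
apply/cvg_ex; exists (l : row_space); apply/cvgrPdist_lt => e e0.
have /filter_forall : forall j, \forall x \near F, `|l 0 j - (x : 'rV[R]_n) 0 j| < e / C.
  by move=> j; move/cvgrPdist_lt: (cvF j) => /(_ (e / C) (divr_gt0 e0 C0)); rewrite mxE.
apply: filterS => x lx; apply: le_lt_trans (pC _) _.
rewrite mulrC -ltr_pdivlMr// [ltLHS]/Num.norm /= mx_normrE.
apply/bigmax_ltP; split=> [|[i j] _ /=]; first exact: divr_gt0.
by rewrite ord1 !mxE; have := lx j; rewrite mxE.
Qed.

HB.instance Definition _ := Uniform_isComplete.Build row_space row_space_cauchy_cvg.

Lemma row_space_exists : exists (A : completeNormedModType R)
    (k : {linear 'rV[R]_n -> A}), bijective k /\ forall x, `|k x| = p x.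
Proof.
pose k (x : 'rV[R]_n) : row_space := x.
have kl : linear k by [].
pose kL : {linear 'rV[R]_n -> row_space} :=
  HB.pack k (GRing.isLinear.Build R 'rV[R]_n row_space _ k kl).
by exists row_space, kL; split=> //; exists id.
Qed.

End row_norms.

Section linear_maps.
Variables (R : realType).

Lemma linear_exists (V W : lmodType R) (k : V -> W) :
  linear k -> exists u : {linear V -> W}, forall x, u x = k x.
Proof.
move=> kl.
by exists (HB.pack_for {linear V -> W} k (GRing.isLinear.Build R V W _ k kl)).
Qed.

Lemma linear_inverse (V W : lmodType R) (f : {linear V -> W}) : bijective f ->
  exists g : {linear W -> V}, cancel f g /\ cancel g f.
Proof.
case=> g fK gK.
have gl : linear g by move=> a x y; apply: (can_inj fK); rewrite linearP !gK.
have [h hE] := linear_exists gl.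
by exists h; split=> x; rewrite hE.
Qed.

Lemma linear_inj (V W : lmodType R) (f : {linear V -> W}) :
  (forall x, f x = 0 -> x = 0) -> injective f.
Proof.
move=> f0 x y fxy; apply/eqP; rewrite -subr_eq0; apply/eqP/f0.
by rewrite linearB fxy subrr.
Qed.

Lemma injective_surjective_bij (V W : Type) (f : V -> W) :
  injective f -> (forall y, exists x, f x = y) -> bijective f.
Proof.
move=> fi /choice[g gK]; exists g => // x; exact: fi.
Qed.

Lemma linear_set_image (V W : lmodType R) (f : {linear V -> W}) (S : set V) :
  linear_set S -> linear_set (f @` S).
Proof.
move=> lS; split; first by exists 0; [exact: lS.1|exact: linear0].
move=> a _ _ [x Sx <-] [y Sy <-]; exists (a *: x + y); last exact: linearP.
exact: lS.2.
Qed.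

Lemma linear_set_range (V W : lmodType R) (f : {linear V -> W}) :
  linear_set (range f).
Proof. exact: linear_set_image. Qed.

End linear_maps.

Section finite_dim.
Variables (R : realType).
Implicit Types (A : completeNormedModType R) (V : normedModType R).

Lemma finite_dim_row A : finite_dim A ->
  exists n (g : {linear 'rV[R]_n -> A}), bijective g.
Proof.
move=> [n [f /linear_inverse[g [fK gK]]]].
by exists n, g; exists f.
Qed.

Lemma finite_dim_of_row n A (g : {linear 'rV[R]_n -> A}) : bijective g -> finite_dim A.
Proof.
move=> /linear_inverse[f [gK fK]].
by exists n, f; exists g.
Qed.

Lemma finite_dim_row_equiv A : finite_dim A ->
  exists n (g : {linear 'rV[R]_n -> A}) (h : {linear A -> 'rV[R]_n}) c C,
  [/\ cancel g h, cancel h g, 0 < c, 0 < C &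
      forall x, c * `|x| <= `|g x| /\ `|g x| <= C * `|x|].
Proof.
move=> /finite_dim_row[n [g bg]]; have [h [gK hK]] := linear_inverse bg.
have sg := seminorm_comp g; have [C C0 gC] := seminorm_row_le sg.
have [|c c0 gc] := norm_row_ge sg.
  by move=> x /normr0_eq0 gx; rewrite -[x]gK gx linear0.
by exists n, g, h, c, C; split.
Qed.

Lemma finite_dim_bounded A V (u : {linear A -> V}) : finite_dim A ->
  exists2 C, 0 < C & forall x, `|u x| <= C * `|x|.
Proof.
move=> /finite_dim_row_equiv[n [g [h [c [C [gK hK c0 _ gE]]]]]].
have [K K0 uC] := seminorm_row_le (seminorm_comp (u \o g)).
exists (K / c) => [|x]; first exact: divr_gt0.
rewrite -[x]hK; apply: le_trans (uC (h x)) _; rewrite -mulrA ler_pM2l//.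
by rewrite ler_pdivlMl//; exact: (gE _).1.
Qed.

Lemma finite_dim_bounded_below A V (u : {linear A -> V}) : finite_dim A ->
  injective u -> exists2 c, 0 < c & forall x, c * `|x| <= `|u x|.
Proof.
move=> /finite_dim_row_equiv[n [g [h [c [C [gK hK _ C0 gE]]]]]] ui.
have [|k k0 uc] := norm_row_ge (seminorm_comp (u \o g)).
  move=> x /normr0_eq0 /= ugx; rewrite -[x]gK.
  by rewrite (_ : g x = 0) ?linear0//; apply: ui; rewrite ugx linear0.
exists (k / C) => [|x]; first exact: divr_gt0.
rewrite -[x]hK; apply: le_trans (uc (h x)); rewrite -mulrA ler_pM2l//.
by rewrite ler_pdivrMl//; exact: (gE _).2.
Qed.

Lemma row_net n (M e : R) : 0 < e -> exists s : seq 'rV[R]_n,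
  forall x, `|x| <= M -> exists2 y, y \in s & `|x - y| < e.
Proof.
move=> e0; pose S := [set x : 'rV[R]_n | `|x| <= M].
have cS : compact S.
  apply: bounded_closed_compact.
    exists M; split; first exact: num_real.
    by move=> N MN x /= xM; exact: le_trans (ltW MN).
  have -> : S = (fun x : 'rV[R]_n => `|x|) @^-1` [set r | r <= M] by [].
  apply: preimage_closed; last exact: closed_le.
  by move=> x _; exact: norm_continuous.
move: cS; rewrite compact_cover => /(_ _ S (fun x => ball x e)) [].
- by move=> x _; exact: ball_open.
- by move=> x Sx; exists x => //; exact: ballxx.
move=> D DS SD; exists (enum_fset D) => x /SD[y /= Dy].
by rewrite -ball_normE /= distrC => yx; exists y.
Qed.

Lemma finite_dim_net A (e : R) : finite_dim A -> 0 < e -> exists s : seq A,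
  forall x, `|x| <= 1 -> exists2 y, y \in s & `|x - y| <= e.
Proof.
move=> /finite_dim_row_equiv[n [g [h [c [C [gK hK c0 C0 gE]]]]]] e0.
have [s sP] := @row_net n c^-1 (e / C) (divr_gt0 e0 C0).
exists (map g s) => x x1.
have [|y ys xy] := sP (h x).
  rewrite -[leRHS]mulr1 ler_pdivlMl// (le_trans (gE _).1)// hK.
  exact: x1.
exists (g y); first exact: map_f.
rewrite -{1}[x]hK -linearB (le_trans (gE _).2)// mulrC -ler_pdivlMr//.
exact: ltW.
Qed.

Lemma span_row (V : lmodType R) (s : seq V) :
  exists n (G : {linear 'rV[R]_n -> V}),
  [/\ injective G, forall v, v \in s -> exists x, G x = v &
      forall T : set V, linear_set T -> (forall v, v \in s -> T v) ->
      forall x, T (G x)].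
Proof.
elim: s => [|v s [n [G [Gi Gs GT]]]].
  have [|z zE] := @linear_exists R 'rV[R]_0 V (fun=> 0).
    by move=> a x y; rewrite scaler0 addr0.
  exists 0, z; split=> [x y _|//|T lT _ x]; first by rewrite [x]thinmx0 [y]thinmx0.
  by rewrite zE; exact: lT.1.
have [[x Gx]|vG] := pselect (exists x, G x = v).
  exists n, G; split=> // [w|T lT sT y].
    by rewrite inE => /orP[/eqP ->|/Gs//]; exists x.
  by apply: GT => // w ws; apply: sT; rewrite inE ws orbT.
pose k (x : 'rV[R]_(n + 1)) := G (lsubmx x) + rsubmx x 0 0 *: v.
have kl : linear k.
  move=> a x y; rewrite /k !linearP !mxE scalerDr scalerA scalerDl.
  by rewrite addrACA.
have [G' G'E] := linear_exists kl.
exists (n + 1)%N, G'; split.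
- apply: linear_inj => x; rewrite G'E /k => /eqP; rewrite addr_eq0 => /eqP Gx.
  have x0 : rsubmx x 0 0 = 0.
    apply: contrapT => /eqP x0; apply: vG.
    exists (- (rsubmx x 0 0)^-1 *: lsubmx x); rewrite linearZ /= Gx.
    by rewrite scalerN scaleNr opprK scalerA mulVf// scale1r.
  have xl : lsubmx x = 0 by apply: Gi; rewrite Gx x0 scale0r oppr0 linear0.
  rewrite -[x]hsubmxK xl; have -> : rsubmx x = 0.
    by apply/rowP => j; rewrite ord1 x0 mxE.
  by rewrite row_mx0.
- move=> w; rewrite inE => /orP[/eqP ->|/Gs[x <-]].
    exists (row_mx 0 (1%:M)); rewrite G'E /k row_mxKl row_mxKr mxE/=.
    by rewrite linear0 add0r scale1r.
  by exists (row_mx x 0); rewrite G'E /k row_mxKl row_mxKr mxE scale0r addr0.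
- move=> T lT sT x; rewrite G'E /k addrC; apply: lT.2.
    by apply: sT; rewrite mem_head.
  by apply: GT => // w ws; apply: sT; rewrite inE ws orbT.
Qed.

Lemma finite_dim_renorm n (p : 'rV[R]_n -> R) : seminorm_axiom p ->
  (forall x, p x = 0 -> x = 0) -> exists A (k : {linear 'rV[R]_n -> A}),
  [/\ finite_dim A, bijective k & forall x, `|k x| = p x].
Proof.
move=> sp p0; have [A [k [bk kp]]] := row_space_exists sp p0.
by exists A, k; split=> //; exact: finite_dim_of_row bk.
Qed.

Lemma finite_dim_span V (s : seq V) : exists A (j : {linear A -> V}),
  [/\ finite_dim A, isometric j, forall v, v \in s -> exists x, j x = v &
      forall T : set V, linear_set T -> (forall v, v \in s -> T v) ->
      forall x, T (j x)].
Proof.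
have [n [G [Gi Gs GT]]] := span_row s.
have [|A [k [fA bk kG]]] := finite_dim_renorm (seminorm_comp G).
  by move=> x /normr0_eq0; rewrite -(linear0 G) => /Gi.
have [h [kK hK]] := linear_inverse bk.
exists A, (G \o h); split=> //.
- by move=> x /=; rewrite -kG hK.
- by move=> v /Gs[x <-]; exists (k x); rewrite /= kK.
- by move=> T lT sT x; exact: GT.
Qed.

Lemma finite_dim_image A V
  (f : {linear A -> V}) : finite_dim A ->
  exists (B : completeNormedModType R) (j : {linear B -> V}),
  [/\ finite_dim B, isometric j, forall a, exists b, j b = f a &
    forall b, exists a, j b = f a].
Proof.
move=> /finite_dim_row[n [g [h gK hK]]].
have [B [j [fB ij js jT]]] := finite_dim_span [seq f (g (delta_mx 0 i)) | i <- enum 'I_n].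
have fg x : f (g x) = \sum_i x 0 i *: f (g (delta_mx 0 i)).
  rewrite {1}[x]row_sum_delta !linear_sum; apply: eq_bigr => i _.
  by rewrite !linearZ.
exists B, j; split=> // [a|b].
  rewrite -[a]hK fg; have lj := linear_set_range j.
  suff [b _ jb] : range j (\sum_i h a 0 i *: f (g (delta_mx 0 i))) by exists b.
  elim/big_ind : _ => [|x y jx jy|i _]; [exact: lj.1|exact: linear_setD|].
  apply: linear_setZ => //.
  have [|b <-] := js (f (g (delta_mx 0 i))); last by exists b.
  by apply/mapP; exists i; rewrite ?mem_enum.
have [v /mapP[i _ ->]|a _ <-] := jT (range f) (linear_set_range f) _ b.
  by exists (g (delta_mx 0 i)).
by exists a.
Qed.

End finite_dim.

(** * Almost isometric embeddings *)

Section distortion.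
Variables (R : realType) (V W : normedModType R) (u : {linear V -> W}).

Lemma iso_embedding_bounds : iso_embedding u ->
  exists c C, [/\ 0 < c, 0 < C & forall x, c * `|x| <= `|u x| <= C * `|x|].
Proof.
move=> [cu [c c0 uc]].
have /linear_bounded_continuous/linear_boundedP := cu.
move=> /pinfty_ex_gt0[C C0 uC].
by exists c, C; split=> // x; rewrite uc uC.
Qed.

Lemma iso_embedding_of_bounds c C : 0 < c ->
  (forall x, c * `|x| <= `|u x| <= C * `|x|) -> iso_embedding u.
Proof.
move=> c0 uE; split; last by exists c => // x; have /andP[] := uE x.
apply: bounded_linear_continuous; apply/linear_boundedP.
exists C; split; first exact: num_real.
move=> N CN x; have /andP[_ /le_trans] := uE x; apply.
by rewrite ler_wpM2r// ltW.
Qed.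

Lemma distortion_le c C : 0 < c -> c <= C ->
  (forall x, c * `|x| <= `|u x| <= C * `|x|) -> distortion u <= C / c.
Proof.
move=> c0 cC uE; rewrite /distortion ge_max; apply/andP; split.
  by rewrite ler_pdivlMr// mul1r.
have C0 : 0 < C by exact: lt_le_trans cC.
have ub1 : ubound [set `|u x| | x in [set x | `|x| <= 1]] C.
  move=> _ [x /= x1 <-]; have /andP[_ /le_trans] := uE x; apply.
  by rewrite ler_piMr// ltW.
have ub2 : ubound [set `|x| | x in [set x | `|u x| <= 1]] c^-1.
  move=> _ [x /= x1 <-]; rewrite -[leRHS]mulr1 ler_pdivlMl//.
  by have /andP[/le_trans + _] := uE x; apply.
have in1 : [set `|u x| | x in [set x | `|x| <= 1]] 0.
  by exists 0; rewrite /= ?linear0 normr0 ?ler01.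
have in2 : [set `|x| | x in [set x | `|u x| <= 1]] 0.
  by exists 0; rewrite /= ?linear0 normr0 ?ler01.
apply: ler_pM.
- by apply: ub_le_sup in1; exists C.
- by apply: ub_le_sup in2; exists c^-1.
- by apply: ge_sup => //; exists 0.
- by apply: ge_sup => //; exists 0.
Qed.

Lemma distortion_bounds K : iso_embedding u -> distortion u <= K ->
  exists2 c, 0 < c & forall x, c * `|x| <= `|u x| <= K * c * `|x|.
Proof.
move=> iu; have [c [C [c0 C0 uE]]] := iso_embedding_bounds iu.
rewrite /distortion ge_max => /andP[K1 uK].
have [x0|/existsNP[x0 /eqP x0n]] := pselect (forall x : V, x = 0).
  by exists 1 => // x; rewrite (x0 x) linear0 !normr0 !mulr0 lexx.
have hs1 : has_ubound [set `|u x| | x in [set x | `|x| <= 1]].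
  exists C => _ [x /= x1 <-]; have /andP[_ /le_trans] := uE x; apply.
  by rewrite ler_piMr// ltW.
have hs2 : has_ubound [set `|x| | x in [set x | `|u x| <= 1]].
  exists c^-1 => _ [x /= x1 <-]; rewrite -[leRHS]mulr1 ler_pdivlMl//.
  by have /andP[/le_trans + _] := uE x; apply.
have u1 x : `|u x| <= opnorm u * `|x|.
  have [->|xn] := eqVneq x 0; first by rewrite linear0 !normr0 mulr0.
  rewrite -ler_pdivrMr ?normr_gt0//; apply: (ub_le_sup hs1).
  exists (`|x|^-1 *: x) => /=.
    by rewrite normrZ normfV normr_id mulVf// normr_eq0.
  by rewrite linearZ normrZ normfV normr_id mulrC.
have u2 x : `|x| <= opnorm_inv u * `|u x|.
  have [->|xn] := eqVneq x 0; first by rewrite linear0 !normr0 mulr0.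
  have ux0 : 0 < `|u x|.
    by have /andP[+ _] := uE x; apply: lt_le_trans; rewrite mulr_gt0 ?normr_gt0.
  rewrite -ler_pdivrMr//; apply: (ub_le_sup hs2).
  exists (`|u x|^-1 *: x) => /=.
    by rewrite linearZ normrZ normfV normr_id mulVf// gt_eqF.
  by rewrite normrZ normfV normr_id mulrC.
have oi : 0 < opnorm_inv u.
  have := u2 x0; rewrite ltNge => + ; apply: contraTN => oi.
  rewrite -ltNge (le_lt_trans _ (_ : 0 < _)) ?normr_gt0//.
  by rewrite mulr_le0_ge0.
exists (opnorm_inv u)^-1 => [|x]; first by rewrite invr_gt0.
rewrite ler_pdivrMl// u2 /=; apply: le_trans (u1 x) _.
by rewrite ler_wpM2r// ler_pdivlMr.
Qed.

End distortion.

Section almost_embeddings.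
Variables (R : realType).
Implicit Types (V W U : normedModType R) (A B X Y : completeNormedModType R).

Definition near_isometry V W (e : R) (u : {linear V -> W}) :=
  forall x, `|x| <= `|u x| <= (1 + e) * `|x|.

Definition almost_embeds V W :=
  forall e : R, 0 < e -> exists u : {linear V -> W}, near_isometry e u.

Lemma exists_sqr_1D_le (e : R) : 0 < e -> exists2 d, 0 < d & (1 + d) * (1 + d) <= 1 + e.
Proof.
move=> e0; exists (Num.min 1 (e / 3)); first by rewrite lt_min; lra.
set d := Num.min _ _.
have d1 : d <= 1 by rewrite ge_min lexx.
have d3 : d <= e / 3 by rewrite ge_min lexx orbT.
have d0 : 0 < d by rewrite lt_min; lra.
nra.
Qed.

Lemma near_isometry_comp V W U (d e : R) (u : {linear V -> W}) (v : {linear W -> U}) :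
  0 <= e -> near_isometry d u -> near_isometry e v ->
  forall x, `|x| <= `|v (u x)| <= (1 + d) * (1 + e) * `|x|.
Proof.
move=> e0 uE vE x; have /andP[u1 u2] := uE x; have /andP[v1 v2] := vE (u x).
rewrite (le_trans u1)//= (le_trans v2)// [(1 + d) * _]mulrC -mulrA.
by rewrite ler_wpM2l//; lra.
Qed.

Lemma near_isometry_inj V W (e : R) (u : {linear V -> W}) : near_isometry e u ->
  injective u.
Proof.
move=> uE; apply: linear_inj => x ux; have /andP[+ _] := uE x.
by rewrite ux normr0 normr_le0 => /eqP.
Qed.

Lemma isometric_near V W (e : R) (u : {linear V -> W}) : 0 <= e -> isometric u ->
  near_isometry e u.
Proof. by move=> e0 iu x; rewrite iu lexx ler_peMl//; lra. Qed.

Lemma isometric_inj V W (u : {linear V -> W}) : isometric u -> injective u.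
Proof. by move=> /(isometric_near ler01)/near_isometry_inj. Qed.

Lemma almost_embeds_approx V W :
  (forall e, 0 < e -> exists U (u : {linear V -> U}), near_isometry e u /\
    almost_embeds U W) -> almost_embeds V W.
Proof.
move=> H e /exists_sqr_1D_le[d d0 de]; have [U [u [uE /(_ d d0)[v vE]]]] := H d d0.
exists (v \o u) => x /=; have /andP[-> /le_trans] := near_isometry_comp (ltW d0) uE vE x.
by apply; rewrite ler_wpM2r.
Qed.

Lemma isometric_almost_embeds V W (u : {linear V -> W}) : isometric u ->
  almost_embeds V W.
Proof. by move=> iu e e0; exists u; apply: isometric_near => //; exact: ltW. Qed.

Lemma finite_dim_factor A V (u : {linear A -> V}) : finite_dim A ->
  exists B (v : {linear A -> B}) (j : {linear B -> V}),
  [/\ finite_dim B, isometric j, forall a, j (v a) = u a &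
      forall b, exists a, v a = b].
Proof.
move=> fA; have [B [j [fB ij uj ju]]] := finite_dim_image u fA.
have [v vE] := choice uj; have ji := isometric_inj ij.
have [|w wE] := @linear_exists _ _ _ v.
  by move=> a x y; apply: ji; rewrite vE !linearP !vE.
exists B, w, j; split=> // [a|b]; first by rewrite wE.
by have [a ja] := ju b; exists a; rewrite wE; apply: ji; rewrite vE.
Qed.

Lemma finite_dim_bij A B (v : {linear A -> B}) n : bijective v ->
  has_dim n A -> has_dim n B.
Proof.
move=> /linear_inverse[w [vK wK]] [f bf]; exists (f \o w).
by apply: bij_comp bf _; exists v.
Qed.

Lemma near_isometry_distortion V W (e : R) (u : {linear V -> W}) : 0 <= e ->
  near_isometry e u -> iso_embedding u /\ distortion u <= 1 + e.
Proof.
move=> e0 uE; have uE' x : 1 * `|x| <= `|u x| <= (1 + e) * `|x| by rewrite mul1r.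
split; first exact: iso_embedding_of_bounds uE'.
by rewrite -[leRHS]divr1; apply: distortion_le uE'; rewrite // lerDl.
Qed.

Lemma distortion_near_isometry V W (e : R) (u : {linear V -> W}) :
  iso_embedding u -> distortion u <= 1 + e ->
  exists v : {linear V -> W}, near_isometry e v.
Proof.
move=> iu /(distortion_bounds iu)[c c0 uE].
have [|v vE] := @linear_exists _ _ _ (fun x => c^-1 *: u x).
  by move=> a x y; rewrite linearP scalerDr !scalerA mulrC.
exists v => x; rewrite vE normrZ gtr0_norm ?invr_gt0//.
by rewrite ler_pdivlMl// ler_pdivrMl// mulrA [c * (1 + e)]mulrC uE.
Qed.

Lemma fin_repP X Y : fin_rep X Y <->
  forall A, finite_dim A -> forall j : {linear A -> X}, isometric j -> almost_embeds A Y.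
Proof.
split=> [XY A fA j ij e e0|XY e e0 A fA j ij].
  by have [u iu] := XY e e0 A fA j ij; exact: distortion_near_isometry.
have [u uE] := XY A fA j ij e e0; exists u.
  by have [] := near_isometry_distortion (ltW e0) uE.
by have [] := near_isometry_distortion (ltW e0) uE.
Qed.

Lemma fin_rep_almost_embeds X Y A : fin_rep X Y -> finite_dim A ->
  almost_embeds A X -> almost_embeds A Y.
Proof.
move=> /fin_repP XY fA AX; apply: almost_embeds_approx => e e0.
have [u uE] := AX e e0; have [B [v [j [fB ij juv _]]]] := finite_dim_factor u fA.
exists B, v; split; last exact: XY ij.
by move=> x; rewrite -(ij (v x)) juv.
Qed.

Lemma bijective_bm_nonempty A B n : has_dim n A -> has_dim n B ->
  exists u : {linear A -> B}, isomorphism u.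
Proof.
move=> nA [f /linear_inverse[g [fK gK]]].
have [h bh] := nA; have [k [hK kK]] := linear_inverse bh.
pose u := g \o h; have ui : injective u.
  by apply: inj_comp; exact: can_inj.
have fA : finite_dim A by exists n.
have [C C0 uC] := finite_dim_bounded u fA.
have [c c0 uc] := finite_dim_bounded_below fA ui.
exists u; split; last by move=> y; exists (k (f y)); rewrite /u /= kK fK.
by apply: (@iso_embedding_of_bounds _ _ _ _ c C) => // x; rewrite uc uC.
Qed.

Lemma minkowski_baseP X A : minkowski_base X A <-> finite_dim A /\ almost_embeds A X.
Proof.
split=> [MA|[fA AX]].
  split; first by have [B _ [n [nA _ _]]] := MA 1 ltr01; exists n.
  apply: almost_embeds_approx => e e0.
  have le0 : 0 < ln (1 + e) by rewrite ln_gt0// ltrDl.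
  have [B [fB [j ij]] [n [nA nB AB]]] := MA _ le0.
  exists B; suff [u uE] : exists u : {linear A -> B}, near_isometry e u.
    by exists u; split=> //; exact: isometric_almost_embeds ij.
  have [u0 iu0] := bijective_bm_nonempty nA nB.
  have hi : has_inf [set distortion u | u in [set u : {linear A -> B} | isomorphism u]].
    split; first by exists (distortion u0), u0.
    by exists 1 => _ [u _ <-]; rewrite /distortion le_max lexx.
  have bm1 : 1 <= bm_dist A B.
    apply: lb_le_inf; first exact: hi.1.
    by move=> _ [u _ <-]; rewrite /distortion le_max lexx.
  have bmE : bm_dist A B < 1 + e.
    by move: AB; rewrite ltr_ln ?posrE ?(lt_le_trans ltr01 bm1)// addr_gt0.
  have [_ [u iu <-] ul] := inf_lt hi.1 bmE.
  by apply: distortion_near_isometry iu.1 _; exact: ltW.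
move=> e e0; have e20 : 0 < e / 2 by rewrite divr_gt0.
have [u uE] := AX _ e20.
have [B [v [j [fB ij juv sv]]]] := finite_dim_factor u fA.
exists B; first by split=> //; exists j.
have vE : near_isometry (e / 2) v by move=> x; rewrite -(ij (v x)) juv.
have [iv dv] := near_isometry_distortion (ltW e20) vE.
have bv : bijective v by apply: injective_surjective_bij (near_isometry_inj vE) sv.
have [n nA] := fA; exists n; split=> //; first exact: finite_dim_bij bv nA.
have bm : bm_dist A B <= 1 + e / 2.
  apply: le_trans dv; apply: ge_inf.
    by exists 1 => _ [w _ <-]; rewrite /distortion le_max lexx.
  by exists v.
have bm1 : 1 <= bm_dist A B.
  apply: lb_le_inf; first by exists (distortion v), v.
  by move=> _ [w _ <-]; rewrite /distortion le_max lexx.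
apply: (@le_lt_trans _ _ (ln (1 + e / 2))).
  by rewrite ler_ln ?posrE// ?(lt_le_trans _ bm1)//; lra.
by apply: le_lt_trans (le_ln1Dx _) _; lra.
Qed.

End almost_embeddings.

(** * Almost subquotients *)

Section almost_subquotients.
Variables (R : realType).
Implicit Types (V W U : normedModType R) (A B D : completeNormedModType R).

(* The linear relation L is the graph of the quotient map from its first
   projection, a linear subspace of W, onto V. *)
Definition almost_subquotient V W :=
  forall e : R, 0 < e -> exists L : set (W * V), [/\ linear_set L,
    forall w v, L (w, v) -> `|v| <= `|w| &
    forall v, exists2 w, L (w, v) & `|w| <= (1 + e) * `|v|].

Lemma almost_subquotient_trans V W U : almost_subquotient V W ->
  almost_subquotient W U -> almost_subquotient V U.
Proof.
move=> VW WU e /exists_sqr_1D_le[d d0 de].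
have [L [lL Lle Lex]] := VW d d0; have [M [lM Mle Mex]] := WU d d0.
exists [set uv | exists w, M (uv.1, w) /\ L (w, uv.2)]; split.
- split; first by exists 0; split; [exact: lM.1|exact: lL.1].
  move=> a [u v] [u' v'] [w /= [Muw Lwv]] [w' /= [Muw' Lwv']].
  exists (a *: w + w'); split; first exact: (lM.2 a _ _ Muw Muw').
  exact: (lL.2 a _ _ Lwv Lwv').
- by move=> u v [w /= [/Mle wu /Lle /le_trans]]; apply.
- move=> v; have [w Lwv wv] := Lex v; have [u Muw uw] := Mex w.
  exists u; first by exists w.
  have d10 : 0 <= 1 + d by lra.
  apply: le_trans uw _; apply: le_trans (ler_wpM2l d10 wv) _.
  by rewrite mulrA ler_wpM2r.
Qed.

Lemma almost_subquotient_approx V W :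
  (forall e, 0 < e -> exists U (u : {linear V -> U}), near_isometry e u /\
    almost_subquotient U W) -> almost_subquotient V W.
Proof.
move=> H e /exists_sqr_1D_le[d d0 de]; have [U [u [uE /(_ d d0)[L [lL Lle Lex]]]]] := H d d0.
exists [set wv | L (wv.1, u wv.2)]; split.
- split; first by rewrite /= linear0; exact: lL.1.
  move=> a [w v] [w' v'] /= Lwv Lwv'; rewrite linearP.
  exact: (lL.2 a _ _ Lwv Lwv').
- by move=> w v /= /Lle; apply: le_trans; have /andP[] := uE v.
- move=> v; have [w Lwv wv] := Lex (u v); exists w => //.
  have d10 : 0 <= 1 + d by lra.
  have /andP[_ uv] := uE v.
  apply: le_trans wv _; apply: le_trans (ler_wpM2l d10 uv) _.
  by rewrite mulrA ler_wpM2r.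
Qed.

Lemma almost_subquotient_refl V : almost_subquotient V V.
Proof.
move=> e e0; exists [set vv | vv.1 = vv.2]; split.
- by split=> // a [x y] [x' y'] /= -> ->.
- by move=> w v /= ->.
- move=> v; exists v; first by [].
  rewrite -[leLHS]mul1r ler_wpM2r// lerDl ltW//.
Qed.

Lemma almost_embeds_subquotient V W : almost_embeds V W -> almost_subquotient V W.
Proof.
move=> VW; apply: almost_subquotient_approx => e e0; have [u uE] := VW e e0.
by exists W, u; split=> //; exact: almost_subquotient_refl.
Qed.

Lemma quotient_subquotient V W (q : {linear W -> V}) :
  (forall v, exists w, q w = v) ->
  (forall w, `|q w| = inf [set `|w - z| | z in [set z | q z = 0]]) ->
  almost_subquotient V W.
Proof.
move=> qs qE.
have hi w : has_inf [set `|w - z| | z in [set z | q z = 0]].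
  split; first by exists `|w - 0|, 0; rewrite //= linear0.
  by exists 0 => _ [z _ <-].
move=> e e0; exists [set wv | q wv.1 = wv.2]; split.
- split; first by rewrite /= linear0.
  by move=> a [x y] [x' y'] /= <- <-; rewrite linearP.
- move=> w _ /= <-; rewrite qE; apply: ge_inf; first exact: (hi w).2.
  by exists 0; rewrite /= ?subr0 ?linear0.
- move=> v; have [->|v0] := eqVneq v 0.
    by exists 0; rewrite /= ?linear0 ?normr0 ?mulr0.
  have [w qw] := qs v.
  have ev : 0 < e * `|v| by rewrite mulr_gt0// normr_gt0.
  have [_ [z /= qz <-]] := inf_adherent ev (hi w).
  rewrite -qE qw => /ltW wz; exists (w - z); first by rewrite /= linearB qz subr0.
  by rewrite mulrDl mul1r.
Qed.

Lemma linear_relation_sum V W (L : set (W * V)) I (r : seq I) (w : I -> W) (v : I -> V) :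
  linear_set L -> (forall i, L (w i, v i)) ->
  L (\sum_(i <- r) w i, \sum_(i <- r) v i).
Proof.
move=> lL Li; elim/big_ind2 : _ => // [|w1 v1 w2 v2 L1 L2]; first exact: lL.1.
exact: (linear_setD lL L1 L2).
Qed.

Definition quotient_norm V W (q : W -> V) (v : V) : R :=
  inf [set `|w| | w in [set w | q w = v]].

Section quotient_norm.
Variables (V W : normedModType R) (q : {linear W -> V}).
Hypothesis qs : forall v, exists w, q w = v.
Let p := quotient_norm q.

Let has_inf_fiber v : has_inf [set `|w| | w in [set w | q w = v]].
Proof.
have [w qw] := qs v; split; first by exists `|w|, w.
by exists 0 => _ [z _ <-].
Qed.

Lemma quotient_norm_le w : p (q w) <= `|w|.
Proof. by apply: ge_inf; [exact: (has_inf_fiber _).2|exists w]. Qed.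

Lemma quotient_norm_adherent v e : 0 < e ->
  exists2 w, q w = v & `|w| < p v + e.
Proof.
by move=> e0; have [_ [w qw <-]] := inf_adherent e0 (has_inf_fiber v); exists w.
Qed.

Lemma quotient_norm_ge v c : (forall w, q w = v -> c <= `|w|) -> c <= p v.
Proof.
move=> H; apply: lb_le_inf; first exact: (has_inf_fiber v).1.
by move=> _ [w qw <-]; exact: H.
Qed.

Lemma quotient_norm_seminorm : seminorm_axiom p.
Proof.
have pZ a v : p (a *: v) <= `|a| * p v.
  have [->|a0] := eqVneq a 0.
    by rewrite scale0r normr0 mul0r -(linear0 q) -(normr0 W) quotient_norm_le.
  rewrite -ler_pdivrMl ?normr_gt0//; apply: quotient_norm_ge => w qw.
  by rewrite ler_pdivrMl ?normr_gt0// -normrZ -qw -linearZ quotient_norm_le.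
split=> [x y|a x].
  apply/ler_addgt0Pr => e e0; have e20 : 0 < e / 2 by rewrite divr_gt0.
  have [w <- wx] := quotient_norm_adherent x e20.
  have [z <- zy] := quotient_norm_adherent y e20.
  rewrite -linearD; apply: le_trans (quotient_norm_le _) _.
  apply: le_trans (ler_normD _ _) _.
  by move: wx zy; set P1 := p _; set P2 := p _; lra.
apply/eqP; rewrite eq_le pZ/=.
have [->|a0] := eqVneq a 0.
  rewrite normr0 mul0r; apply: quotient_norm_ge => w _; exact: normr_ge0.
rewrite -ler_pdivlMl ?normr_gt0//.
by have := pZ a^-1 (a *: x); rewrite scalerA mulVf// scale1r normfV.
Qed.

End quotient_norm.

Lemma almost_subquotient_finite_dim A W e : finite_dim A -> almost_subquotient A W ->
  0 < e -> exists D (j : {linear D -> W}) (q : {linear D -> A}),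
  [/\ finite_dim D, isometric j, forall b, `|q b| <= `|b| &
      forall a, exists2 b, q b = a & `|b| <= (1 + e) * `|a|].
Proof.
move=> fA AW e0; have e20 : 0 < e / 2 by rewrite divr_gt0.
have [L [lL Lle Lex]] := AW _ e20.
have [n [g [h gK hK]]] := finite_dim_row fA.
have [lf lfL] : exists lf : A -> W, forall a, L (lf a, a) /\ `|lf a| <= (1 + e / 2) * `|a|.
  have /choice[lf lfE] : forall a, exists w, L (w, a) /\ `|w| <= (1 + e / 2) * `|a|.
    by move=> a; have [w] := Lex a; exists w.
  by exists lf.
have [h' [gK' hK']] := linear_inverse (Bijective gK hK).
pose bas i := g (delta_mx 0 i : 'rV[R]_n).
have [l lE] : exists l : {linear A -> W}, forall a, l a = \sum_i h' a 0 i *: lf (bas i).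
  apply: linear_exists => c x y; rewrite scaler_sumr -big_split; apply: eq_bigr => i _.
  by rewrite linearP !mxE scalerDl scalerA.
have lL' a : L (l a, a).
  rewrite lE -{2}[a]hK' {2}[h' a]row_sum_delta linear_sum.
  apply: linear_relation_sum => // i; rewrite linearZ.
  exact: (linear_setZ _ lL (lfL (bas i)).1).
have [C C0 lC] := finite_dim_bounded l fA.
pose K := 1 + e / 2 + C; have K0 : 0 < K by rewrite /K; lra.
have eK : 0 < e / 2 / K by rewrite divr_gt0.
have [s sP] := finite_dim_net fA eK.
pose S := [seq lf a | a <- s ++ [seq bas i | i <- enum 'I_n]].
have [D [j [fD ij js jT]]] := finite_dim_span S.
have ji := isometric_inj ij.
have /choice[q qE] : forall b, exists a, L (j b, a).
  apply: (jT [set w | exists a, L (w, a)]).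
    split; first by exists 0; exact: lL.1.
    by move=> c x y [a La] [b Lb]; exists (c *: a + b); exact: (lL.2 _ _ _ La Lb).
  by move=> _ /mapP[a _ ->]; exists a; exact: (lfL a).1.
have Lfun w a b : L (w, a) -> L (w, b) -> a = b.
  move=> La Lb; have /Lle := linear_setB lL La Lb.
  by rewrite /= subrr normr0 normr_le0 subr_eq0 => /eqP.
have [q' q'E] : exists q' : {linear D -> A}, forall b, q' b = q b.
  apply: linear_exists => c x y; apply: (Lfun _ _ _ (qE _)).
  by rewrite linearP; exact: (lL.2 c _ _ (qE x) (qE y)).
have lift1 a : a \in s -> exists2 b, q' b = a & `|b| <= (1 + e / 2) * `|a|.
  move=> sa; have [|b jb] := js (lf a).
    by apply: map_f; rewrite mem_cat sa.
  exists b; last by rewrite -ij jb (lfL a).2.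
  by rewrite q'E; apply: (Lfun _ _ _ (qE _)); rewrite jb; exact: (lfL a).1.
have lift2 a : exists2 b, q' b = a & `|b| <= C * `|a|.
  have [b _ jb] : range j (l a).
    have lj := linear_set_range j; rewrite lE; elim/big_ind : _ => [|x y jx jy|i _].
    - exact: lj.1.
    - exact: linear_setD.
    - apply: linear_setZ => //; have [|b <-] := js (lf (bas i)); last by exists b.
      by apply: map_f; rewrite mem_cat map_f ?orbT ?mem_enum.
  exists b; last by rewrite -ij jb.
  by rewrite q'E; apply: (Lfun _ _ _ (qE _)); rewrite jb.
exists D, j, q'; split=> // [b|a]; first by rewrite q'E -ij; exact: Lle.
have [->|a0] := eqVneq a 0.
  by exists 0; rewrite ?linear0 ?normr0 ?mulr0.
have na0 : 0 < `|a| by rewrite normr_gt0.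
have [|y ys ay] := sP (`|a|^-1 *: a).
  by rewrite normrZ normfV normr_id mulVf// gt_eqF.
have [b1 qb1 b1y] := lift1 y ys; have [b2 qb2 b2y] := lift2 (`|a|^-1 *: a - y).
exists (`|a| *: (b1 + b2)).
  by rewrite linearZ linearD /= qb1 qb2 addrC subrK scalerA mulfV ?gt_eqF// scale1r.
rewrite normrZ normr_id mulrC ler_wpM2r//.
have y1 : `|y| <= 1 + e / 2 / K.
  rewrite -[y](subrK (`|a|^-1 *: a)) (le_trans (ler_normD _ _))// addrC lerD//.
    by rewrite normrZ normfV normr_id mulVf// gt_eqF.
  by rewrite distrC.
apply: le_trans (ler_normD _ _) _; apply: le_trans (lerD b1y b2y) _.
have h1 : (1 + e / 2) * `|y| <= (1 + e / 2) * (1 + e / 2 / K).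
  by rewrite ler_wpM2l//; lra.
have h2 : C * `|(`|a|^-1 *: a - y)%R| <= C * (e / 2 / K) by rewrite ler_wpM2l// ltW.
apply: le_trans (lerD h1 h2) _.
have -> : (1 + e / 2) * (1 + e / 2 / K) + C * (e / 2 / K) =
          1 + e / 2 + K * (e / 2 / K) by rewrite /K; ring.
by rewrite mulrCA mulfV ?gt_eqF// mulr1; lra.
Qed.

Lemma almost_subquotient_quotient A W e : finite_dim A -> almost_subquotient A W ->
  0 < e -> exists A' D (k : {linear A -> A'}) (j : {linear D -> W}) (q : {linear D -> A'}),
  [/\ finite_dim A' /\ finite_dim D, near_isometry e k, isometric j, 
      forall a, exists b, q b = a &
      forall b, `|q b| = inf [set `|b - z| | z in [set z | q z = 0]]].
Proof.
move=> fA AW e0.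
have [D [j [q [fD ij qle qex]]]] := almost_subquotient_finite_dim fA AW e0.
have qs a : exists b, q b = a by have [b] := qex a; exists b.
have sp := quotient_norm_seminorm qs; set p := quotient_norm q in sp.
have [n [g bg]] := finite_dim_row fA; have [h [gK hK]] := linear_inverse bg.
have pge a : `|a| <= p a.
  by apply: quotient_norm_ge => // b <-.
have [||A' [k [fA' bk kp]]] := @finite_dim_renorm R n (p \o g).
- by split=> [x y|a x] /=; rewrite ?linearD ?linearZ; [exact: sp.1|exact: sp.2].
- move=> x /= pg0; have := pge (g x); rewrite pg0 normr_le0 => /eqP gx.
  by rewrite -[x]gK gx linear0.
have [k' [kK k'K]] := linear_inverse bk.
exists A', D, (k \o h), j, (k \o (h \o q)); split=> //.
- move=> a /=; rewrite kp /= hK pge /=.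
  have [b <- bq] := qex a; apply: le_trans bq.
  exact: quotient_norm_le.
- by move=> a; have [b qb] := qs (g (k' a)); exists b; rewrite /= qb gK k'K.
- move=> b /=; rewrite kp /= hK /p /quotient_norm; congr inf.
  apply/seteqP; split=> [_ [w /= qw <-]|_ [z /= qz <-]].
    exists (b - w); last by rewrite opprB addrC subrK.
    have -> : k (h (q (b - w))) = k (h (q b - q w)) by rewrite linearB.
    by rewrite qw subrr !linear0.
  exists (b - z) => //; rewrite linearB /=.
  suff -> : q z = 0 by rewrite subr0.
  by rewrite -[q z]hK -[h (q z)]kK qz !linear0.
Qed.

End almost_subquotients.

Section l2_sums.
Variables (R : realType).
Implicit Types (Y V W : nat -> completeNormedModType R).

Lemma choice_dep (T : nat -> Type) (P : forall n, T n -> Prop) :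
  (forall n, exists x, P n x) -> exists f : forall n, T n, forall n, P n (f n).
Proof.
move=> H; exists (fun n => sval (cid (H n))) => n; exact: svalP.
Qed.

Lemma l2_ext Y (x y : l2sum Y) : (forall n, x n = y n) -> x = y.
Proof.
by move=> xy; apply: val_inj; exact: functional_extensionality_dep.
Qed.

Lemma l2_sqr_norm Y (x : l2sum Y) :
  ((`|x| ^+ 2)%:E = \esum_(n in [set: nat]) (`|x n| ^+ 2)%:E)%E.
Proof.
have cx : cvgn [series `|x n| ^+ 2]_n by have /asboolP := l2P x.
rewrite -nneseries_esumT//.
rewrite [ `|x| ]/(l2norm x) /l2norm sqr_sqrtr; last first.
  by apply: limr_ge => //; apply: nearW => n; apply: sumr_ge0 => k _; exact: sqr_ge0.
rewrite -EFin_lim//; congr (limn _); apply/funext => n /=.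
by rewrite sumEFin.
Qed.

Lemma l2_exists Y (x : forall n, Y n) :
  (\esum_(n in [set: nat]) (`|x n| ^+ 2)%:E < +oo)%E ->
  exists z : l2sum Y, forall n, z n = x n.
Proof.
move=> xoo.
have x0 : (0 <= \esum_(n in [set: nat]) (`|x n| ^+ 2)%:E)%E.
  by apply: esum_ge0 => n _; rewrite lee_fin.
suff xP : l2_pred (x : l2_family Y) by exists (L2sum xP).
apply/asboolP; apply: nondecreasing_is_cvgn.
  by apply/nondecreasing_seqP => n; rewrite /series/= big_nat_recr//= lerDl.
exists (fine (\esum_(n in [set: nat]) (`|x n| ^+ 2)%:E)) => _ [n _ <-].
rewrite -lee_fin fineK ?ge0_fin_numE//= -sumEFin -nneseries_esumT//.
by apply: nneseries_lim_ge => k _ _; rewrite lee_fin.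
Qed.

Lemma l2_norm_le Y V (x : l2sum Y) (y : l2sum V) K : 0 <= K ->
  (forall n, `|x n| <= K * `|y n|) -> `|x| <= K * `|y|.
Proof.
move=> K0 xy.
have xy2 : ((`|x| ^+ 2)%:E <= (`|K *: y| ^+ 2)%:E)%E.
  rewrite !l2_sqr_norm; apply: le_esum => n _.
  rewrite lee_fin lerXn2r ?nnegrE// (le_trans (xy n))//.
  by rewrite [(K *: y)%R n]/(K *: y n) normrZ ger0_norm.
move: xy2; rewrite lee_fin ler_sqr ?nnegrE// => /le_trans; apply.
by rewrite normrZ ger0_norm.
Qed.

Lemma l2_norm_eq Y V (x : l2sum Y) (y : l2sum V) :
  (forall n, `|x n| = `|y n|) -> `|x| = `|y|.
Proof.
move=> xy; apply/eqP; rewrite eq_le; apply/andP; split.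
  by rewrite -[leRHS]mul1r; apply: l2_norm_le => // n; rewrite mul1r xy.
by rewrite -[leRHS]mul1r; apply: l2_norm_le => // n; rewrite mul1r xy.
Qed.

Lemma l2_dominated Y V (x : forall n, Y n) (y : l2sum V) K : 0 <= K ->
  (forall n, `|x n| <= K * `|y n|) -> exists z : l2sum Y, forall n, z n = x n.
Proof.
move=> K0 xy; apply: l2_exists.
apply: (@le_lt_trans _ _ (`|K *: y| ^+ 2)%:E); last exact: ltry.
rewrite l2_sqr_norm; apply: le_esum => n _.
rewrite lee_fin lerXn2r ?nnegrE// (le_trans (xy n))//.
by rewrite [(K *: y)%R n]/(K *: y n) normrZ ger0_norm.
Qed.

Lemma l2_injection Y n : exists i : {linear Y n -> l2sum Y},
  isometric i /\ forall x, i x n = x.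
Proof.
pose i0 (x : Y n) m : Y m := if n =P m is ReflectT e then ecast k (Y k) e x else 0.
have i0n x : i0 x n = x.
  by rewrite /i0; case: eqP => // e; rewrite eq_axiomK.
have i0P a x y m : i0 (a *: x + y) m = a *: i0 x m + i0 y m.
  rewrite /i0; case: eqP => [e|_]; first by case: m / e.
  by rewrite scaler0 addr0.
have i0E x : (\esum_(m in [set: nat]) (`|i0 x m| ^+ 2)%:E = (`|x| ^+ 2)%:E)%E.
  transitivity (\esum_(m in [set n]) (`|i0 x m| ^+ 2)%:E)%E.
    rewrite [RHS]esum_mkcond; apply: eq_esum => m _.
    case: ifPn => // /negP; rewrite in_setE /= => mn.
    by rewrite /i0; case: eqP => [/esym//|_]; rewrite normr0 expr0n.
  by rewrite esum_set1 ?i0n// lee_fin.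
have /choice[i iE] x : exists z : l2sum Y, forall m, z m = i0 x m.
  by apply: l2_exists; rewrite i0E; exact: ltry.
have [|j jE] := @linear_exists _ _ _ i.
  by move=> a x y; apply: l2_ext => m; rewrite iE i0P -!iE.
exists j; split=> x; rewrite jE ?iE//.
apply/eqP; rewrite -(@eqrXn2 _ 2)//; apply/eqP/EFin_inj.
apply: etrans (l2_sqr_norm (i x)) (etrans _ (i0E x)).
by apply: eq_esum => m _; rewrite iE.
Qed.

Lemma almost_subquotient_l2 V W : (forall n, almost_subquotient (V n) (W n)) ->
  almost_subquotient (l2sum V) (l2sum W).
Proof.
move=> VW e e0; have e10 : 0 <= 1 + e by lra.
have [L LE] := choice_dep (fun n => VW n e e0).
exists [set wv : l2sum W * l2sum V | forall n, L n (wv.1 n, wv.2 n)]; split.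
- split; first by move=> n; have [[]] := LE n.
  move=> a [w v] [w' v'] /= Lwv Lwv' n; have [[_ lL] _ _] := LE n.
  exact: (lL a _ _ (Lwv n) (Lwv' n)).
- move=> w v /= Lwv; rewrite -[leRHS]mul1r; apply: l2_norm_le => // n.
  by rewrite mul1r; have [_ + _] := LE n; apply; exact: Lwv.
- move=> v.
  have wP n : exists w, L n (w, v n) /\ `|w| <= (1 + e) * `|v n|.
    by have [_ _ /(_ (v n))[w]] := LE n; exists w.
  have [w wE] := choice_dep wP.
  have [z zE] := l2_dominated e10 (fun n => (wE n).2).
  exists z => [n /=|]; first by rewrite zE; exact: (wE n).1.
  by apply: l2_norm_le => // n; rewrite zE (wE n).2.
Qed.

Lemma l2_l2_isometry (W : completeNormedModType R) :
  exists u : {linear l2sum (fun=> l2_power W) -> l2_power W}, isometric u.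
Proof.
have /card_set_bijP[p pbij] : ([set: nat] #= [set: nat * nat])%card.
  by rewrite card_eq_sym; exact: card_nat2.
pose flat (x : l2sum (fun=> l2_power W)) n : W := x (p n).1 (p n).2.
have flatE x : ((`|x| ^+ 2)%:E = \esum_(n in [set: nat]) (`|flat x n| ^+ 2)%:E)%E.
  rewrite l2_sqr_norm.
  under eq_esum do rewrite l2_sqr_norm.
  rewrite esum_esum; last by move=> i j _ _; rewrite lee_fin.
  rewrite (_ : [set: nat] `*`` _ = [set: nat * nat]); last by apply/seteqP; split.
  exact: (reindex_esum [set: nat] [set: nat * nat] p (fun k => (`|x k.1 k.2| ^+ 2)%:E)
    pbij).
have /choice[u uE] x : exists z : l2_power W, forall n, z n = flat x n.
  by apply: l2_exists; rewrite -flatE; exact: ltry.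
have [|v vE] := @linear_exists _ _ _ u.
  by move=> a x y; apply: l2_ext => n; rewrite uE [RHS]/(a *: u x n + u y n) !uE.
exists v => x; rewrite vE; apply/eqP.
rewrite -(@eqrXn2 _ 2)//; apply/eqP/EFin_inj.
apply: etrans (l2_sqr_norm (u x)) (etrans _ (esym (flatE x))).
by apply: eq_esum => n _; rewrite uE.
Qed.

Lemma l2_coordinate Y n :
  exists c : {linear l2sum Y -> Y n}, forall x, c x = x n.
Proof. exact: linear_exists. Qed.

Lemma almost_subquotient_l2_local (A W : completeNormedModType R) Y :
  finite_dim A -> almost_embeds A (l2sum Y) ->
  (forall n (B : completeNormedModType R) (j : {linear B -> Y n}),
    finite_dim B -> isometric j -> almost_subquotient B W) ->
  almost_subquotient A (l2_power W).
Proof.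
move=> fA AY YW; apply: almost_subquotient_approx => e e0.
have [u uE] := AY e e0.
have BP n : exists (B : completeNormedModType R) (v : {linear A -> B})
    (j : {linear B -> Y n}),
    [/\ finite_dim B, isometric j & forall a, j (v a) = u a n].
  have [c cE] := l2_coordinate Y n.
  have [B [v [j [fB ij jE _]]]] := finite_dim_factor (c \o u) fA.
  by exists B, v, j; split=> // a; rewrite jE /= cE.
have [B vP] := choice_dep BP; have [v jP] := choice_dep vP.
have [j BE] := choice_dep jP.
have vn n a : `|v n a| = `|u a n|.
  by have [_ ij <-] := BE n; rewrite ij.
have /choice[w wE] a : exists z : l2sum B, forall n, z n = v n a.
  by apply: (@l2_dominated B Y (fun n => v n a) (u a) 1) => // n; rewrite mul1r vn.
have [|w' w'E] := @linear_exists _ _ _ w.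
  move=> a x y; apply: l2_ext => n.
  by rewrite wE [RHS]/(a *: w x n + w y n) !wE linearP.
exists (l2sum B), w'; split.
  move=> a; rewrite w'E (@l2_norm_eq B Y _ (u a)); first exact: uE.
  by move=> n; rewrite wE vn.
apply: almost_subquotient_l2 => n; have [fB ij _] := BE n; exact: YW ij.
Qed.

Lemma almost_subquotient_l2_l2 (V : normedModType R) (W : completeNormedModType R) :
  almost_subquotient V (l2_power (l2_power W)) -> almost_subquotient V (l2_power W).
Proof.
move=> VW; apply: almost_subquotient_trans VW _.
have [u iu] := l2_l2_isometry W.
exact/almost_embeds_subquotient/(isometric_almost_embeds iu).
Qed.

End l2_sums.

(** * Duality *)

Section linear_spans.
Variables (R : realType) (V : lmodType R).

Definition linear_span (s : seq V) : set V :=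
  fun v => forall T : set V, linear_set T -> (forall w, w \in s -> T w) -> T v.

Lemma linear_set_span s : linear_set (linear_span s).
Proof.
split; first by move=> T lT _; exact: lT.1.
by move=> a x y sx sy T lT sT; apply: lT.2; [exact: sx|exact: sy].
Qed.

Lemma mem_linear_span s v : v \in s -> linear_span s v.
Proof. by move=> vs T _; apply. Qed.

Lemma linear_span_sub s t : {subset s <= t} -> linear_span s `<=` linear_span t.
Proof. by move=> st v sv T lT tT; apply: sv => // w /st; exact: tT. Qed.

End linear_spans.

Section goldstine.
Variables (R : realType) (V : normedModType R).
Implicit Types (fs : seq (dual V)).

Lemma linear_set_common_kernel fs :
  linear_set [set x | forall f, f \in fs -> f x = 0].
Proof.
split=> [f _|a x y x0 y0 f ffs]; first exact: linear0.
by rewrite linearP /= (x0 _ ffs) (y0 _ ffs) scaler0 addr0.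
Qed.

Lemma common_kernel_span fs (g : dual V) :
  (forall x, (forall f, f \in fs -> f x = 0) -> g x = 0) -> linear_span fs g.
Proof.
elim: fs g => [|f fs ih] g gE.
  suff -> : g = 0 by exact: (linear_set_span _).1.
  by apply: val_inj; apply/funext => x; exact: gE.
have ssub : linear_span fs `<=` linear_span (f :: fs).
  by apply: linear_span_sub => h hfs; rewrite inE hfs orbT.
have [[x0 [fs0 /eqP f0]]|fs0] :=
    pselect (exists x0, (forall h, h \in fs -> h x0 = 0) /\ f x0 <> 0).
  pose a := g x0 / f x0.
  have -> : g = a *: f + (g - a *: f) by rewrite addrC subrK.
  have [_ lS] := linear_set_span (f :: fs).
  apply: lS; first by apply: mem_linear_span; rewrite mem_head.
  apply: (ssub); apply: ih => x fsx.
  pose y := x - (f x / f x0) *: x0.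
  have /gE : forall h, h \in f :: fs -> h y = 0.
    move=> h; rewrite inE /y linearB linearZ /= => /orP[/eqP ->|hfs].
      by rewrite /GRing.scale/= divfK ?subrr.
    by rewrite (fsx _ hfs) (fs0 _ hfs) /GRing.scale/= mulr0 subr0.
  rewrite /y linearB linearZ /= /GRing.scale/= => gy.
  apply: (@etrans _ _ (g x - a * f x)) => //.
  by rewrite -gy /a; congr (_ - _); rewrite mulrC mulrCA mulrC.
apply: (ssub); apply: ih => x fsx; apply: gE => h; rewrite inE => /orP[/eqP ->|/fsx//].
by apply: contrapT => fx; apply: fs0; exists x.
Qed.

Lemma goldstine fs (phi : dual (dual V)) (e : R) : 0 < e ->
  exists2 x, (forall f, f \in fs -> f x = phi f) & `|x| <= `|phi| + e.
Proof.
move=> e0.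
have linear_set_agree x : linear_set [set f : dual V | f x = phi f].
  split; first by rewrite /= linear0.
  by move=> a f g /= fx gx; rewrite linearP /= -fx -gx.
have [x0 x0E] : exists x, forall f, f \in fs -> f x = phi f.
  elim: fs => [|f fs [x xE]]; first by exists 0.
  have [[x0 [fs0 /eqP f0]]|fs0] :=
      pselect (exists x0, (forall h, h \in fs -> h x0 = 0) /\ f x0 <> 0).
    exists (x + ((phi f - f x) / f x0) *: x0) => h.
    rewrite inE linearD linearZ /= => /orP[/eqP ->|hfs].
      by rewrite /GRing.scale/= divfK// addrC subrK.
    by rewrite (fs0 _ hfs) /GRing.scale/= mulr0 addr0 xE.
  exists x => h; rewrite inE => /orP[/eqP ->|/xE//].
  have sf : linear_span fs f.
    apply: common_kernel_span => y fsy.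
    by apply: contrapT => fy; apply: fs0; exists y.
  exact: (sf _ (linear_set_agree x)).
apply: contrapT => H.
pose N := [set x : V | forall f, f \in fs -> f x = 0].
have d0 : 0 < `|phi| + e by rewrite ltr_wpDl.
have [|||g [gN gx g1]] := @dual_separation _ _ N x0 (`|phi| + e).
- exact: linear_set_common_kernel.
- by [].
- move=> z Nz; rewrite leNgt; apply/negP => /ltW xz; apply: H.
  by exists (x0 - z) => // f ffs; rewrite linearB /= Nz// subr0 x0E.
have sg : linear_span fs g by exact: common_kernel_span.
have : g x0 = phi g.
  exact: (sg _ (linear_set_agree x0)).
rewrite gx => phig; have := dual_le_norm phi g; rewrite -phig gtr0_norm//.
have := ler_wpM2l (normr_ge0 phi) g1; rewrite mulr1; lra.
Qed.

End goldstine.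

Section reflexivity.
Variables (R : realType).
Implicit Types (F : completeNormedModType R).

Lemma evaluation_exists F : exists J : {linear F -> dual (dual F)},
  isometric J /\ forall x f, J x f = f x.
Proof.
have /choice[J JE] (x : F) : exists phi : dual (dual F), forall f, phi f = f x.
  have [|ev evE] := @linear_exists _ _ R^o (fun f : dual F => f x); first by [].
  have [|phi phiE] := @dual_of_bounded _ _ ev `|x|.
    by move=> f; rewrite evE mulrC dual_le_norm.
  by exists phi => f; rewrite phiE evE.
have [|K KE] := @linear_exists _ _ _ J.
  move=> a x y; apply: val_inj; apply/funext => f.
  rewrite -[LHS]/(J (a *: x + y) f) -[RHS]/(a *: J x f + J y f).
  by rewrite !JE linearP.
exists K; split=> [x|x f]; last by rewrite KE.
apply/eqP; rewrite eq_le KE; apply/andP; split.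
  by apply: dual_norm_le => // f; rewrite JE mulrC dual_le_norm.
have [f fx f1] := dual_norming x.
have := dual_le_norm (J x) f; rewrite JE fx ger0_norm// => /le_trans; apply.
by rewrite ler_piMr.
Qed.

Lemma reflexive_of_reflexive_dual F : reflexive_space (dual F) -> reflexive_space F.
Proof.
move=> rF phi; have [J [iJ JE]] := evaluation_exists F.
suff [x xE] : exists x, phi = J x by exists x => f; rewrite xE.
apply: contrapT => phiJ.
have [d d0 dP] : exists2 d, 0 < d & forall x, d <= `|phi - J x|.
  apply: contrapT => H; apply: phiJ.
  have /choice[x xE] n : exists x, `|phi - J x| < n.+1%:R^-1.
    apply: contrapT => Hn; apply: H; exists n.+1%:R^-1; first by rewrite invr_gt0.
    by move=> x; rewrite leNgt; apply/negP => xn; apply: Hn; exists x.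
  have cx : cauchy (x @ \oo).
    apply: cauchy_exP => e e0.
    have [N _ NP] := near_infty_natSinv_lt (PosNum (divr_gt0 e0 (ltr0Sn R 1))).
    exists (x N); exists N => // n Nn; rewrite -ball_normE /=.
    rewrite -iJ linearB (_ : J (x N) - J (x n) =
      (phi - J (x n)) - (phi - J (x N))); last by rewrite opprB [RHS]addrC addrA subrK.
    rewrite (le_lt_trans (ler_normB _ _))// [ltRHS]splitr ltrD//.
      by apply: lt_trans (xE n) _; exact: NP.
    by apply: lt_trans (xE N) _; apply: NP => /=.
  have [l xl] : exists l : F, x @ \oo --> l by apply/cvg_ex; exact: cauchy_cvg.
  exists l; apply/eqP; rewrite -subr_eq0 -normr_le0; apply/ler_addgt0Pr => e e0.
  rewrite add0r; have e20 : 0 < e / 2 by rewrite divr_gt0.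
  have [N _ NP] := near_infty_natSinv_lt (PosNum e20).
  move/cvgrPdist_lt: xl => /(_ _ e20)[M _ MP].
  pose n := maxn N M.
  have -> : phi - J l = (phi - J (x n)) - J (l - x n).
    by rewrite linearB opprB addrA subrK.
  rewrite (le_trans (ler_normB _ _))// [leRHS]splitr lerD//.
    by apply/ltW; apply: lt_trans (xE n) _; apply: NP; exact: leq_maxl.
  by rewrite iJ; apply/ltW; apply: MP; exact: leq_maxr.
have [|||g [gJ gphi _]] := @dual_separation _ _ (range J) phi d.
- exact: linear_set_range.
- exact: d0.
- by move=> _ [x _ <-].
have [f fE] := rF g.
have f0 : f = 0.
  apply: val_inj; apply/funext => x; rewrite -[LHS]/(f x) -[RHS]/(0 : R).
  by rewrite -JE -fE gJ.
by move: d0; rewrite -gphi fE f0 linear0 ltxx.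
Qed.

End reflexivity.

Lemma row_linear_set (R : realType) n (T : set 'rV[R]_n) : linear_set T ->
  (forall i, T (delta_mx 0 i)) -> forall x, T x.
Proof.
move=> lT Td x; rewrite [x]row_sum_delta.
elim/big_ind : _ => [|y z Ty Tz|i _]; first exact: lT.1.
  exact: linear_setD.
exact: linear_setZ.
Qed.

Section dual_subspaces.
Variables (R : realType).
Implicit Types (A F Z : completeNormedModType R).

Lemma finite_dim_norming A F (j : {linear A -> dual F}) (e : R) :
  finite_dim A -> isometric j -> 0 < e ->
  exists (P : completeNormedModType R) (i : {linear P -> F}),
  [/\ finite_dim P, isometric i &
    forall a, exists2 x, `|x| <= 1 & (1 - 3 * e) * `|a| <= `|j a (i x)|].
Proof.
move=> fA ij e0; have [s sP] := finite_dim_net fA e0.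
have /choice[x xE] (a : A) : exists x, `|x| <= 1 /\ `|a| - e <= `|j a x|.
  by have [x x1 ax] := dual_almost_norming (j a) e0; exists x; rewrite -(ij a).
have [P [i [fP ii is_ _]]] := finite_dim_span (map x s).
exists P, i; split=> // a.
have [->|a0] := eqVneq a 0.
  by exists 0; rewrite ?normr0 ?mulr0.
have na0 : 0 < `|a| by rewrite normr_gt0.
pose b := `|a|^-1 *: a.
have b1 : `|b| = 1 by rewrite normrZ normfV normr_id mulVf// gt_eqF.
have [|y ys b_y] := sP b; first by rewrite b1.
have [|p ip] := is_ (x y); first exact: map_f.
have [xy1 yx] := xE y.
exists p; first by rewrite -ii ip.
have ab : a = `|a| *: b by rewrite scalerA mulfV ?gt_eqF// scale1r.
have jab : j a (x y) = `|a| * j b (x y) by rewrite {1}ab linearZ.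
rewrite ip jab normrM normr_id mulrC.
rewrite ler_wpM2l//.
have h1 : `|j (b - y) (x y)| <= e.
  apply: le_trans (dual_le_norm _ _) _; rewrite ij.
  by rewrite -[leRHS]mulr1 ler_pM.
have h2 : `|j y (x y)| <= `|j b (x y)| + `|j (b - y) (x y)|.
  have -> : j y (x y) = j b (x y) - j (b - y) (x y).
    have -> : j (b - y) (x y) = j b (x y) - j y (x y) by rewrite linearB.
    by rewrite opprB addrC subrK.
  exact: ler_normB.
have h3 : 1 <= `|y| + e.
  rewrite -b1 -[b](subrK y) addrC (le_trans (ler_normD _ _))// lerD//.
lra.
Qed.

Lemma almost_subquotient_dual A F Z (j : {linear A -> dual F}) :
  finite_dim A -> isometric j -> fin_rep F (dual Z) -> almost_subquotient A Z.
Proof.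
move=> fA ij /fin_repP FZ e e0.
pose h := Num.min (1 / 12) (e / 12).
have h0 : 0 < h by rewrite lt_min; lra.
have h12 : h <= 1 / 12 by rewrite ge_min lexx.
have he : h <= e / 12 by rewrite ge_min lexx orbT.
have [P [i [fP ii iP]]] := finite_dim_norming fA ij h0.
have [u uE] := FZ P fP i ii h h0.
have ui := near_isometry_inj uE.
pose K := (1 + h) / (1 - 3 * h).
have h3 : 0 < 1 - 3 * h by lra.
have K0 : 0 < K by rewrite divr_gt0//; lra.
have KE : K * (1 - 3 * h) = 1 + h by rewrite /K divfK// gt_eqF.
have Ke : K * (1 + h) <= 1 + e.
  rewrite -(ler_pM2r h3) mulrAC KE; nra.
exists [set za | forall p, u p za.1 = K * j za.2 (i p)]; split.
- split; first by move=> p; rewrite /= !linear0 mulr0.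
  move=> a [z b] [z' b'] /= zb zb' p.
  have -> : j (a *: b + b') (i p) = a * j b (i p) + j b' (i p) by rewrite linearP.
  have -> : u p (a *: z + z') = a * u p z + u p z' by exact: linearP.
  by rewrite zb zb' /=; ring.
- move=> z a /= za; have [p p1 ap] := iP a.
  have /andP[_ up] := uE p.
  have zb : `|K * j a (i p)| <= (1 + h) * `|z|.
    rewrite -za; apply: le_trans (dual_le_norm _ _) _; rewrite ler_wpM2r//.
    apply: le_trans up _; rewrite -[leRHS]mulr1 ler_wpM2l//; lra.
  rewrite normrM (gtr0_norm K0) in zb.
  have := ler_wpM2l (ltW K0) ap; rewrite mulrA KE => /le_trans/(_ zb).
  rewrite ler_pM2l//; lra.
- move=> a; have [->|a0] := eqVneq a 0.
    exists 0; last by rewrite !normr0 mulr0.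
    by move=> p /=; rewrite !linear0 mulr0.
  have na0 : 0 < `|a| by rewrite normr_gt0.
  have /choice[v vE] f : exists p, forall q, u q = f -> p = q.
    have [[p pf]|pf] := pselect (exists p, u p = f).
      by exists p => q uq; apply: ui; rewrite pf uq.
    by exists 0 => q uq; exfalso; apply: pf; exists q.
  have vu p : v (u p) = p by exact: vE.
  have [|_ [p _ <-]|phi phiE phia] := @dual_extension _ _ (range u)
    (fun f => j a (i (v f)) : R^o) `|a| (normr_ge0 a) (linear_set_range u).
  + by move=> c _ _ [p _ <-] [q _ <-]; rewrite -linearP !vu !linearP.
  + rewrite vu; apply: le_trans (dual_le_norm _ _) _; rewrite ij ler_wpM2l//.
    by rewrite ii; have /andP[] := uE p.
  have [n [g [g' gK g'K]]] := finite_dim_row fP.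
  have [z zE zn] := goldstine [seq u (g (delta_mx 0 i)) | i <- enum 'I_n] phi
    (mulr_gt0 h0 na0).
  have uz p : u p z = j a (i p).
    rewrite -[p in RHS]vu -phiE; last by exists p.
    rewrite -[p]g'K; apply: (@row_linear_set _ _ [set x | u (g x) z = phi (u (g x))]).
      split; first by rewrite /= !linear0.
      move=> c x y /= xz yz; have -> : u (g (c *: x + y)) = c *: u (g x) + u (g y).
        by rewrite !linearP.
      by rewrite linearP /= -xz -yz.
    by move=> k; apply: zE; apply/mapP; exists k; rewrite ?mem_enum.
  exists (K *: z) => [p /=|].
    have -> : u p (K *: z) = K * u p z by exact: linearZ.
    by rewrite uz.
  rewrite normrZ (gtr0_norm K0).
  have za : `|z| <= (1 + h) * `|a| by rewrite mulrDl mul1r; lra.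
  apply: le_trans (ler_wpM2l (ltW K0) za) _.
  by rewrite mulrA ler_wpM2r.
Qed.

End dual_subspaces.

(** * Classes closed under subquotients *)

Lemma fin_rep_trans (R : realType) (X Y Z : completeNormedModType R) :
  fin_rep X Y -> fin_rep Y Z -> fin_rep X Z.
Proof.
move=> /fin_repP XY YZ; apply/fin_repP => A fA j ij.
exact: fin_rep_almost_embeds YZ fA (XY A fA j ij).
Qed.

Lemma isometric_fin_rep (R : realType) (X Y : completeNormedModType R)
  (u : {linear X -> Y}) : isometric u -> fin_rep X Y.
Proof.
move=> iu; apply/fin_repP => A fA j ij.
by apply: (isometric_almost_embeds (u := u \o j)) => x /=; rewrite iu ij.
Qed.

Lemma dual_adjoint (R : realType) (V W : normedModType R) (u : {linear V -> W}) :
  (forall x, `|u x| <= `|x|) ->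
  exists t : {linear dual W -> dual V},
    (forall f, `|t f| <= `|f|) /\ forall f x, t f x = f (u x).
Proof.
move=> ule.
have fule (f : dual W) x : `|f (u x)| <= `|f| * `|x|.
  by apply: le_trans (dual_le_norm _ _) _; rewrite ler_wpM2l.
have /choice[t tE] (f : dual W) : exists g : dual V, forall x, g x = f (u x).
  exact: (@dual_of_bounded _ _ (f \o u) `|f| (fule f)).
have [|t' t'E] := @linear_exists _ _ _ t.
  move=> a f g; apply: val_inj; apply/funext => x.
  by rewrite -[LHS]/(t (a *: f + g) x) -[RHS]/(a *: t f x + t g x) !tE.
exists t'; split=> [f|f x]; last by rewrite t'E tE.
by apply: dual_norm_le => // x; rewrite t'E tE.
Qed.

Section starstar_base.
Variables (R : realType) (X W : completeNormedModType R).
Hypothesis baseX : forall A, minkowski_base X A <->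
  subspaces_of (quotients_of (minkowski_base (l2_power W))) A.
Implicit Types (A F : completeNormedModType R).

Lemma almost_embeds_of_subquotient A : finite_dim A ->
  almost_subquotient A (l2_power W) -> almost_embeds A X.
Proof.
move=> fA AW; apply: almost_embeds_approx => e e0.
have [A' [D [k [j [q [[fA' fD] kE ij qs qE]]]]]] := almost_subquotient_quotient fA AW e0.
exists A', k; split=> //.
suff /minkowski_baseP[] : minkowski_base X A' by [].
apply/baseX; exists A'.
  exists D; last by exists q.
  by apply/minkowski_baseP; split=> //; exact: isometric_almost_embeds ij.
by exists idfun.
Qed.

Lemma subquotient_of_almost_embeds A : finite_dim A ->
  almost_embeds A X -> almost_subquotient A (l2_power W).
Proof.
move=> fA AX; have /baseX[C [D MD [q [qs qE]]] [j ij]] : minkowski_base X A.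
  exact/minkowski_baseP.
have /minkowski_baseP[_ DW] := MD.
apply: almost_subquotient_trans (almost_embeds_subquotient DW).
apply: almost_subquotient_trans (quotient_subquotient qs qE).
exact/almost_embeds_subquotient/(isometric_almost_embeds ij).
Qed.

Lemma almost_subquotient_dense_sum (Y : nat -> completeNormedModType R) :
  (forall n, minkowski_base (l2_power X) (Y n)) ->
  almost_subquotient (l2sum Y) (l2_power W).
Proof.
move=> MY; apply: almost_subquotient_l2_l2; apply: almost_subquotient_l2 => n.
have /minkowski_baseP[fY YX] := MY n.
apply: almost_subquotient_l2_l2; apply: almost_subquotient_l2_local fY YX _.
move=> _ B j fB ij; apply: subquotient_of_almost_embeds => //.
exact: isometric_almost_embeds ij.
Qed.

Definition l2_with (V : completeNormedModType R) : completeNormedModType R :=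
  l2sum (fun n => if n is 0 then V else X).

Lemma l2_with_fin_equiv F :
  (forall A (j : {linear A -> F}), finite_dim A -> isometric j ->
    almost_subquotient A (l2_power W)) ->
  fin_equiv X (l2_with F).
Proof.
move=> FW; split.
  have [i [ii _]] := l2_injection (fun n => if n is 0 then F else X) 1.
  exact: isometric_fin_rep ii.
apply/fin_repP => A fA j ij; apply: almost_embeds_of_subquotient => //.
apply: almost_subquotient_l2_l2.
apply: (almost_subquotient_l2_local fA (isometric_almost_embeds ij)).
move=> [|n] B k fB ik; first exact: FW ik.
apply: subquotient_of_almost_embeds => //; exact: isometric_almost_embeds ik.
Qed.

Lemma reflexive_of_subquotient F : superreflexive (fclass X) ->
  (forall A (j : {linear A -> F}), finite_dim A -> isometric j ->
    almost_subquotient A (l2_power W)) ->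
  reflexive_space F.
Proof.
move=> sX /l2_with_fin_equiv/sX rF phi.
pose Y n : completeNormedModType R := if n is 0 then F else X.
have [i [ii iE]] := l2_injection Y 0.
have [c cE] := l2_coordinate Y 0.
have cle x : `|c x| <= `|x| by rewrite cE; exact: l2_coord_le.
have [|ia [iale iaE]] := @dual_adjoint _ _ _ i; first by move=> y; rewrite ii.
have [iaa [_ iaaE]] := dual_adjoint iale.
have [ca [_ caE]] := dual_adjoint cle.
have [x xE] := rF (iaa phi); exists (c x) => f.
rewrite -caE -xE iaaE; congr (phi _); apply: val_inj; apply/funext => y.
by rewrite -[RHS]/(ia (ca f) y) iaE caE cE iE.
Qed.

End starstar_base.

(** * Almost universal disposition *)

Section disposition.
Variables (R : realType) (V : normedModType R) (E : completeNormedModType R).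
Variable K : completeNormedModType R -> Prop.
Hypothesis KV : forall (A : completeNormedModType R) (j : {linear A -> V}),
  finite_dim A -> isometric j -> K A.
Hypothesis audE : almost_universal_disposition K E.

Definition embedding_on (S : set V) (d : R) (u : V -> E) : Prop :=
  linear_on S u /\
  exists2 c, 0 < c & forall x, S x -> c * `|x| <= `|u x| <= d * c * `|x|.

Lemma finite_dim_linear_span (s : seq V) :
  exists (A : completeNormedModType R) (j : {linear A -> V}),
  [/\ finite_dim A, isometric j & range j = linear_span s].
Proof.
have [A [j [fA ij js jT]]] := finite_dim_span s.
exists A, j; split=> //; apply/seteqP; split=> [_ [a _ <-] T lT sT|v sv].
  exact: jT.
by apply: sv (linear_set_range j) _ => w /js[a <-]; exists a.
Qed.

Lemma embedding_extension (s t : seq V) (d d' : R) (u : V -> E) :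
  {subset s <= t} -> 1 <= d < d' -> embedding_on (linear_span s) d u ->
  exists u', embedding_on (linear_span t) d' u' /\
    forall x, linear_span s x -> u' x = u x.
Proof.
move=> st /andP[d1 dd'] [ul [c c0 uE]].
have d0 : 0 < d by lra.
have [A [j [fA ij jE]]] := finite_dim_linear_span s.
have [B [k [fB ik kE]]] := finite_dim_linear_span t.
have js a : linear_span s (j a) by rewrite -jE; exists a.
have /choice[w wE] (a : A) : exists b, k b = j a.
  have [b _ kb] : range k (j a) by rewrite kE; exact: (linear_span_sub st).
  by exists b.
have ki := isometric_inj ik.
have [|v vE] := @linear_exists _ _ _ w.
  by move=> a x y; apply: ki; rewrite linearP !wE linearP.
have kv a : k (v a) = j a by rewrite vE wE.
have iv : isometric v by move=> a; rewrite -ik kv ij.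
have [|i iE] := @linear_exists _ _ _ (u \o j).
  by move=> a x y /=; rewrite linearP ul.
have iB a : c * `|a| <= `|i a| <= d * c * `|a| by rewrite iE -(ij a) uE.
have ii : iso_embedding i := iso_embedding_of_bounds c0 iB.
have id : distortion i <= d.
  have cdc : c <= d * c by rewrite ler_peMl// ltW.
  by have := distortion_le c0 cdc iB; rewrite mulfK// gt_eqF.
have e0 : 0 < d' / d - 1 by rewrite subr_gt0 ltr_pdivlMr// mul1r.
have [i' [ii' i'v i'd]] := audE (KV fA ij) (KV fB ik) iv e0 ii.
have [|c' c'0 i'E] := @distortion_bounds _ _ _ i' d' ii'.
  apply: le_trans i'd _; rewrite addrC subrK.
  by rewrite mulrAC ler_pdivrMr// ler_wpM2l//; lra.
have /choice[z zE] (x : V) : exists b, linear_span t x -> k b = x.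
  have [tx|tx] := pselect (linear_span t x); last by exists 0.
  by have [b _ <-] : range k x by [rewrite kE]; exists b.
exists (fun x => i' (z x)); split; last first.
  move=> x; rewrite -jE => -[a _ <-].
  have -> : z (j a) = v a.
    by apply: ki; rewrite kv zE//; apply: (linear_span_sub st); exact: js.
  by rewrite i'v iE.
split=> [a x y tx ty|]; last first.
  exists c' => // x tx; have := i'E (z x).
  by rewrite -(ik (z x)) zE.
rewrite -linearP; congr (i' _); apply: ki.
by rewrite linearP !zE//; exact: (linear_set_span t).2.
Qed.

(* The distortion bounds 2 - 1/(n+1) increase strictly and stay below 2. *)
Lemma embedding_chain (f : nat -> V) : exists U : nat -> V -> E, forall n,
  embedding_on (linear_span (mkseq f n)) (2 - n.+1%:R^-1) (U n) /\
  forall x, linear_span (mkseq f n) x -> U n.+1 x = U n x.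
Proof.
pose d n : R := 2 - n.+1%:R^-1.
pose P n u := embedding_on (linear_span (mkseq f n)) (d n) u.
have /choice[step stepE] (nu : nat * (V -> E)) : exists u', P nu.1 nu.2 ->
    P nu.1.+1 u' /\ forall x, linear_span (mkseq f nu.1) x -> u' x = nu.2 x.
  have [Pu|nP] := pselect (P nu.1 nu.2); last by exists (fun=> 0).
  have [||u' u'E] := @embedding_extension _ (mkseq f nu.1.+1) _ (d nu.1.+1) _ _ _ Pu.
  - by rewrite mkseqS => v vs; rewrite mem_rcons inE vs orbT.
  - rewrite /d ltrD2l ltrN2 ltf_pV2 ?posrE// ltr_nat ltnS leqnn andbT.
    rewrite lerBrDr -lerBrDl (_ : 2 - 1 = 1); last by ring.
    by rewrite invf_le1// ler1n.
  - by exists u'.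
pose U := fix U n := if n is m.+1 then step (m, U m) else fun=> 0.
have PU n : P n (U n).
  elim: n => [|n ih]; last by have [] := stepE (n, U n) ih.
  have s0 x : linear_span (mkseq f 0) x -> x = 0.
    move=> /(_ [set 0]); apply=> //.
    by split=> // a _ _ -> ->; rewrite scaler0 addr0.
  split=> [a x y _ _|]; first by rewrite /= scaler0 addr0.
  by exists 1 => // x /s0 ->; rewrite !normr0 !mulr0 lexx.
exists U => n; split; first exact: PU.
by have [] := stepE (n, U n) (PU n).
Qed.

Lemma embedding_union (f : nat -> V) : f 0 != 0 -> exists (u : V -> E) (S : set V) (r : R),
  [/\ linear_set S, forall n, S (f n), linear_on S u, 0 < r &
    forall x, S x -> r * `|x| <= `|u x| <= 4 * r * `|x|].
Proof.
move=> f0; have [U UE] := embedding_chain f.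
pose s n := linear_span (mkseq f n).
have sS n : s n `<=` s n.+1.
  by apply: linear_span_sub => v vs; rewrite mkseqS mem_rcons inE vs orbT.
have s_mono m n : (m <= n)%N -> s m `<=` s n.
  move=> /subnKC <-; elim: (n - m)%N => [|k ih]; first by rewrite addn0.
  by rewrite addnS => x /ih; exact: sS.
have U_mono m n x : (m <= n)%N -> s m x -> U n x = U m x.
  move=> /subnKC <- sx; elim: (n - m)%N => [|k ih]; first by rewrite addn0.
  by rewrite addnS (UE _).2//; apply: s_mono sx; rewrite leq_addr.
pose S := [set x | exists n, s n x].
have /choice[n nE] x : exists n, S x -> s n x.
  by have [[n sx]|Sx] := pselect (S x); [exists n|exists 0%N].
pose u x := U (n x) x.
have uE m x : s m x -> u x = U m x.
  move=> sx; have snx : s (n x) x by apply: nE; exists m.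
  rewrite /u -(U_mono (n x) (maxn m (n x)) x) ?leq_maxr//.
  by rewrite (U_mono m)// leq_maxl.
have sl m : linear_set (s m) by exact: linear_set_span.
have Slin a x y : S x -> S y -> exists m, [/\ s m x, s m y & s m (a *: x + y)].
  move=> [m sx] [k sy]; exists (maxn m k).
  have sx' : s (maxn m k) x by apply: s_mono sx; exact: leq_maxl.
  have sy' : s (maxn m k) y by apply: s_mono sy; exact: leq_maxr.
  by split=> //; exact: (sl _).2.
have f01 : s 1 (f 0) by apply: mem_linear_span; rewrite mem_head.
have nf0 : 0 < `|f 0| by rewrite normr_gt0.
pose r := `|u (f 0)| / `|f 0|.
have bounds m : (0 < m)%N -> exists c,
    [/\ 0 < c, c <= r, r <= 2 * c &
      forall x, s m x -> c * `|x| <= `|u x| <= 2 * c * `|x|].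
  move=> m0; have [[_ [c c0 cE]] _] := UE m.
  have cE' x : s m x -> c * `|x| <= `|u x| <= 2 * c * `|x|.
    move=> sx; rewrite (uE m)//; have /andP[-> /le_trans] := cE x sx; apply.
    by rewrite ler_wpM2r// (ler_wpM2r (ltW c0))// gerBl.
  exists c; split=> //.
    by rewrite ler_pdivlMr//; have /andP[] := cE' (f 0) (s_mono _ _ m0 _ f01).
  by rewrite ler_pdivrMr//; have /andP[] := cE' (f 0) (s_mono _ _ m0 _ f01).
have [c1 [c10 c1r _ _]] := bounds 1 isT.
exists u, S, (r / 2); split.
- split; first by exists 0%N; exact: (sl _).1.
  by move=> a x y Sx Sy; have [m [_ _ ?]] := Slin a x y Sx Sy; exists m.
- move=> m; exists m.+1; apply: mem_linear_span.
  by rewrite mkseqS mem_rcons mem_head.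
- move=> a x y Sx Sy; have [m [sx sy sxy]] := Slin a x y Sx Sy.
  by rewrite !(uE m)//; have [[Ul _] _] := UE m; exact: Ul.
- by rewrite divr_gt0// (lt_le_trans c10).
- move=> x [m sx]; have [c [c0 cr rc cE]] := bounds m.+1 isT.
  have /andP[x1 x2] := cE x (sS _ _ sx).
  apply/andP; split.
    by apply: le_trans x1; rewrite ler_wpM2r//; lra.
  by apply: le_trans x2 _; rewrite ler_wpM2r//; lra.
Qed.

End disposition.

Lemma separable_seq (R : realType) (F : completeNormedModType R) (x0 : F) :
  separable F -> exists y : nat -> F,
    y 0 = x0 /\ forall x e, 0 < e -> exists n, `|x - y n| < e.
Proof.
move=> [D cD dD].
have /pcard_leTP[g] : (D #<= [set: nat])%card by [].
pose y n := if n is m.+1 then xget 0 [set x | D x /\ g x = m] else x0.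
exists y; split=> // x e e0.
have [||z [xz Dz]] := dD (ball x e).
- by exists x; exact: ballxx.
- exact: ball_open.
exists (g z).+1; rewrite /y; case: xgetP => [w _ [Dw gw]|/(_ z)]; last by case.
have -> : w = z by apply: (@inj _ _ D g) => //; exact: mem_set.
by move: xz; rewrite -ball_normE.
Qed.

Section quotient_of_dual.
Variables (R : realType) (F E : completeNormedModType R).
Hypothesis rF : reflexive_space F.

(* A functional on S that is bounded for the norm of F^* is evaluation at a
   point of F, which is unique because S separates the points of F. *)
Lemma dual_surjection (S : set (dual F)) (u : dual F -> E) (r s : R) :
  0 < r -> 0 < s -> linear_set S -> linear_on S u ->
  (forall f, S f -> r * `|f| <= `|u f| <= s * `|f|) ->
  (forall y, (forall f, S f -> f y = 0) -> y = 0) ->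
  exists q : {linear dual E -> F}, continuous q /\ forall y, exists g, q g = y.
Proof.
move=> r0 s0 lS lu uE Ssep.
have [J [iJ JE]] := evaluation_exists F.
have /choice[q qE] (g : dual E) : exists y,
    (forall f, S f -> f y = g (u f)) /\ `|y| <= s * `|g|.
  have [|a f h Sf Sh|f Sf|phi phiE phin] := @dual_extension _ _ S
    (fun f => g (u f) : R^o) (s * `|g|) _ lS.
  - by rewrite mulr_ge0// ltW.
  - by rewrite lu// linearP.
  - apply: le_trans (dual_le_norm _ _) _; rewrite mulrC mulrAC ler_wpM2r//.
    by have /andP[] := uE f Sf.
  have [y yE] := rF phi; exists y; split=> [f Sf|]; first by rewrite -yE phiE.
  have Jy : J y = phi.
    by apply: val_inj; apply/funext => f; rewrite -[RHS]/(phi f) yE -JE.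
  by rewrite -iJ Jy.
have Suniq y z : (forall f, S f -> f y = f z) -> y = z.
  move=> yz; apply/eqP; rewrite -subr_eq0; apply/eqP/Ssep => f Sf.
  by rewrite linearB /= (yz _ Sf) subrr.
have [|p pE] := @linear_exists _ _ _ q.
  move=> a g h; apply: Suniq => f Sf.
  by rewrite linearP /= (qE _).1// (qE g).1// (qE h).1.
exists p; split.
  apply: bounded_linear_continuous; apply/linear_boundedP.
  exists s; split; first exact: num_real.
  move=> N sN g; rewrite pE; apply: le_trans (qE g).2 _.
  by rewrite ler_wpM2r// ltW.
move=> y.
have u_inj f h : S f -> S h -> u f = u h -> f = h.
  move=> Sf Sh fh; apply/eqP; rewrite -subr_eq0 -normr_le0 -(ler_pM2l r0) mulr0.
  have Sfh : S (f - h) by exact: linear_setB.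
  have /andP[/le_trans + _] := uE _ Sfh; apply.
  have -> : u (f - h) = u f - u h.
    by rewrite addrC -scaleN1r lu// scaleN1r addrC.
  by rewrite fh subrr normr0.
have /choice[v vE] (x : E) : exists f, forall h, S h -> u h = x -> f = h.
  have [[h [Sh hx]]|nh] := pselect (exists h, S h /\ u h = x).
    by exists h => k Sk kx; apply: u_inj => //; rewrite hx.
  by exists 0 => h Sh hx; exfalso; apply: nh; exists h.
have vu f : S f -> v (u f) = f by move=> Sf; exact: vE.
have [||||g gE _] := @dual_extension _ _ (u @` S) (fun x => v x y : R^o) (`|y| / r).
- by rewrite divr_ge0// ltW.
- split.
    have [S0 _] := lS; exists 0 => //; rewrite -(subrr 0) -scaleN1r addrC lu//.
    by rewrite scaleN1r addNr.
  move=> a _ _ [f Sf <-] [h Sh <-]; exists (a *: f + h); last by rewrite lu.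
  exact: lS.2.
- move=> a _ _ [f Sf <-] [h Sh <-]; rewrite -lu// !vu//.
  exact: lS.2.
- move=> _ [f Sf <-]; rewrite vu//; apply: le_trans (dual_le_norm _ _) _.
  rewrite mulrAC ler_pdivlMr// mulrC mulrA [leLHS]mulrC ler_wpM2l//.
  by have /andP[] := uE f Sf.
exists g; rewrite pE; apply: Suniq => f Sf.
by rewrite (qE g).1// gE ?vu//; exists f.
Qed.

End quotient_of_dual.

Theorem theorem14 (R : realType) (X EX : completeNormedModType R)
    (ss_closed : starstar_closed (fclass X))
    (superrefl : superreflexive (fclass X))
    (EX_in : fclass X EX)
    (EX_sep : separable EX)
    (EX_aud : almost_universal_disposition (minkowski_base X) EX)
    (Y : nat -> completeNormedModType R)
    (Y_dense : bm_dense_seq Y (minkowski_base (l2_power X))) :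
  couniversal (dual EX)
    (fun F => separable F /\ fin_rep_in (star_class Y) F).
Proof.
move=> F [sF [G GY FG]].
have [W XW] := ss_closed.
have XX : fclass X X.
  by split; apply: (@isometric_fin_rep _ _ _ idfun).
have /XW baseX := XX.
have FY : fin_rep F (dual (l2sum Y)) := fin_rep_trans FG GY.2.
have subF (A : completeNormedModType R) (j : {linear A -> dual F}) :
    finite_dim A -> isometric j ->
    almost_subquotient A (l2_power W).
  move=> fA ij; apply: almost_subquotient_trans (almost_subquotient_dual fA ij FY) _.
  exact: (almost_subquotient_dense_sum baseX Y_dense.1).
have baseF (A : completeNormedModType R) (j : {linear A -> dual F}) :
    finite_dim A -> isometric j ->
    minkowski_base X A.
  move=> fA ij; apply/minkowski_baseP; split=> //.
  exact: (almost_embeds_of_subquotient baseX fA (subF _ _ fA ij)).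
have rF : reflexive_space F.
  apply: reflexive_of_reflexive_dual.
  exact: (reflexive_of_subquotient baseX superrefl subF).
have [F0|/existsNP[x0 /eqP x0n]] := pselect (forall x : F, x = 0).
  have [|q qE] := @linear_exists _ (dual EX) F (fun=> 0).
    by move=> a x y; rewrite scaler0 addr0.
  exists q; split; last by move=> y; exists 0; rewrite qE (F0 y).
  have -> : (q : dual EX -> F) = cst 0 by apply/funext.
  exact: cst_continuous.
have [y [y0 yd]] := separable_seq x0 sF.
have /choice[f fE] n : exists f : dual F, f (y n) = `|y n| /\ `|f| <= 1.
  by have [f] := dual_norming (y n); exists f.
have f0 : f 0%N != 0.
  apply/eqP => f00; have := (fE 0%N).1; rewrite f00 y0 => /esym/eqP.
  by rewrite normr_eq0 (negbTE x0n).
have [u [S [r [lS Sf lu r0 uE]]]] := embedding_union baseF EX_aud f0.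
apply: (dual_surjection rF r0 _ lS lu uE); first by rewrite mulr_gt0.
move=> x Sx; apply/eqP; rewrite -normr_le0; apply/ler_addgt0Pr => e e0.
rewrite add0r; have e20 : 0 < e / 2 by rewrite divr_gt0.
have [n xn] := yd x _ e20.
have yn : `|y n| <= `|x - y n|.
  have [<- fn1] := fE n.
  have -> : f n (y n) = - f n (x - y n) by rewrite linearB /= (Sx _ (Sf n)) sub0r opprK.
  rewrite (le_trans (ler_norm _))// normrN (le_trans (dual_le_norm _ _))//.
  by rewrite ler_piMl.
rewrite -[x](subrK (y n)) (le_trans (ler_normD _ _))//; lra.
Qed.
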